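(* Let $\mathcal{F}=\{\varphi_1,\dots,\varphi_Q\}\subset[-\pi,\pi[$, $\varphi_1<\dots<\varphi_Q$, be a fixed finite angle set, and consider families of discretizations with widths $\delta_s,\delta_x>0$ as described in the context. Let $\delta_s\to0$ and $\frac{\delta_x}{\delta_s}\to0$. Then for any $f\in L^2(\Omega)$ and $g\in L^2(\Omega'_{\mathcal{F}})$ it holds that $$\lim_{\delta_s\to0}\|\mathcal{R}^{\mathcal{F}}f-\mathcal{R}_{\delta_s,\delta_\varphi}^{\delta_x}f\|=0\quad\text{as well as}\quad\lim_{\delta_s\to0}\|(\mathcal{R}^{\mathcal{F}})^*g-(\mathcal{R}_{\delta_s,\delta_\varphi}^{\delta_x})^*g\|=0.$$ If $\delta_x=\mathcal{O}(\delta_s^{1+\epsilon})$ for some $\epsilon>0$, then for $f\in L^2(\Omega)$ with $\omega_{\mathcal{R}^{\mathcal{F}}f}(h,0)=\mathcal{O}(|h|^{\epsilon})$ and $g\in L^2(\Omega'_{\mathcal{F}})$ with $\omega_g(h,0)=\mathcal{O}(|h|^\epsilon)$ it holds that $$\|\mathcal{R}^{\mathcal{F}}f-\mathcal{R}_{\delta_s,\delta_\varphi}^{\delta_x}f\|=\mathcal{O}(\delta_s^\epsilon)\quad\text{as well as}\quad\|(\mathcal{R}^{\mathcal{F}})^*g-(\mathcal{R}_{\delta_s,\delta_\varphi}^{\delta_x})^*g\|=\mathcal{O}(\delta_s^\epsilon).$$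
   Context: Let $\Omega=B(0,1)\subset\mathbb{R}^2$ be the unit ball, $\vartheta(\varphi)=(\cos\varphi,\sin\varphi)$, $\vartheta(\varphi)^\perp=(-\sin\varphi,\cos\varphi)$, and $\Omega'_{\mathcal{F}}={]{-1,1}[}\times\mathcal{F}$. The space $L^2(\Omega'_{\mathcal{F}})$ uses Lebesgue measure in the offset and counting measure in the angle: $\|g\|^2=\sum_{q=1}^Q\int_{]-1,1[}|g(s,\varphi_q)|^2\,ds$. Functions on $\Omega$ are extended by zero to $\mathbb{R}^2$, functions on $\Omega'_{\mathcal{F}}$ by zero to $\mathbb{R}\times\mathcal{F}$. Sparse-angle Radon transform: $[\mathcal{R}^{\mathcal{F}}f](s,\varphi_q)=\int_{\mathbb{R}}f\bigl(s\vartheta(\varphi_q)+t\vartheta(\varphi_q)^\perp\bigr)\,dt$, extended by continuity to a linear continuous operator $L^2(\Omega)\to L^2(\Omega'_{\mathcal{F}})$; $(\cdot)^*$ denotes Hilbert space adjoints. Modulus of continuity in the offset for $g\in L^2(\Omega'_{\mathcal{F}})$: $\omega_g(h,0)=\bigl(\sum_{q=1}^Q\int_{\mathbb{R}}|g(s+h,\varphi_q)-g(s,\varphi_q)|^2\,ds\bigr)^{1/2}$; statements $\omega_g(h,0)=\mathcal{O}(|h|^\epsilon)$ are for $h\to0$. Discretization. Offsets: $P\in\mathbb{N}$, $\delta_s>0$, $s_p=\delta_s\bigl(p-\frac{P+1}{2}\bigr)$, $S_p=[s_p-\frac{\delta_s}{2},s_p+\frac{\delta_s}{2}[$, $p=1,\dots,P$,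 with ${]{-1,1}[}\subset\bigcup_pS_p$. Image grid: $N,M\in\mathbb{N}$, $\delta_x>0$, $x_{ij}=\delta_x\bigl(i-\frac{N+1}{2},j-\frac{M+1}{2}\bigr)$, $X_{ij}=x_{ij}+[-\frac{\delta_x}{2},\frac{\delta_x}{2}[^2$, $i=1,\dots,N$, $j=1,\dots,M$, with $\Omega\subset\bigcup_{i,j}X_{ij}$. Let $w_{\delta_s}(t)=\max(0,\delta_s-|t|)$. There is no angular discretization (the angle set is fixed). The fully discrete sparse-angle transform $\mathcal{R}_{\delta_s,\delta_\varphi}^{\delta_x}:L^2(\Omega)\to L^2(\Omega'_{\mathcal{F}})$ is $$[\mathcal{R}_{\delta_s,\delta_\varphi}^{\delta_x}f](s,\varphi_q)=\frac{1}{\delta_s^2}\sum_{p=1}^P\chi_{S_p}(s)\sum_{i=1}^{N}\sum_{j=1}^{M}w_{\delta_s}\bigl(x_{ij}\cdot\vartheta(\varphi_q)-s_p\bigr)\int_{X_{ij}}f(x)\,dx,\qquad q=1,\dots,Q.$$ *)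

(* Defs.v *)
From HB Require Import structures.
From mathcomp Require Import all_boot all_order all_algebra.
From mathcomp Require Import all_classical all_reals all_analysis.

Set Implicit Arguments.
Unset Strict Implicit.
Unset Printing Implicit Defensive.

Import Order.TTheory GRing.Theory Num.Theory.
Import numFieldNormedType.Exports.

Local Open Scope classical_set_scope.
Local Open Scope ring_scope.

Section Geometry.
Context {R : realType}.

Definition theta (a : R) : R * R := (cos a, sin a).

Definition theta_perp (a : R) : R * R := (- sin a, cos a).

Definition dotp (x y : R * R) : R := x.1 * y.1 + x.2 * y.2.

(* The Euclidean ball; the norm MathComp-Analysis puts on R * R is the sup
   norm. *)
Definition Omega : set (R * R) := [set x | dotp x x < 1].

Definition offsets : set R := `]-1, 1[%classic.

End Geometry.

(* A sinogram, i.e. a function on ]-1, 1[ x {phi_1, ..., phi_Q}, is a family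
   g : 'I_Q -> R -> R, where g q s stands for g(s, phi_q).  Elements of the L^2
   spaces are represented by Borel functions defined everywhere, whose values
   outside Omega, resp. ]-1, 1[, are ignored; norms and inner products depend
   on the classes only. *)
Notation leb := lebesgue_measure.
Notation leb2 := (lebesgue_measure \x lebesgue_measure)%E.

Section L2_spaces.
Context {R : realType}.

Definition L2_image : set (R * R -> R) :=
  [set f | (f \_ Omega) \in Lfun leb2 2%:E].

Definition norm_image (f : R * R -> R) : \bar R :=
  'N[leb2]_2%:E[EFin \o (f \_ Omega)].

Definition ip_image (f h : R * R -> R) : R :=
  \int[leb2]_(x in Omega) (f x * h x).

Definition L2_sino (Q : nat) : set ('I_Q -> R -> R) :=
  [set g | forall q, (g q \_ offsets) \in Lfun leb 2%:E].

Definition norm_sino (Q : nat) (g : 'I_Q -> R -> R) : \bar R :=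
  ((\sum_q \int[leb]_(s in offsets) (`|g q s| ^+ 2)%:E) `^ 2^-1)%E.

Definition ip_sino (Q : nat) (g h : 'I_Q -> R -> R) : R :=
  \sum_q \int[leb]_(s in offsets) (g q s * h q s).

Definition omega (Q : nat) (g : 'I_Q -> R -> R) (h : R) : R :=
  Num.sqrt (\sum_q \int[leb]_s
    (`|(g q \_ offsets) (s + h) - (g q \_ offsets) s| ^+ 2)).

(* adjoint A g is a representative of A^* g, the element of L^2(Omega) that
   represents the functional f |-> <A f, g>. *)
Definition adjoint (Q : nat) (A : (R * R -> R) -> 'I_Q -> R -> R)
    (g : 'I_Q -> R -> R) : R * R -> R :=
  xget (cst 0) [set h | L2_image h /\
    forall f, L2_image f -> ip_sino (A f) g = ip_image f h].

End L2_spaces.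

Section Radon.
Context {R : realType} (Q : nat) (phi : 'I_Q -> R).

Definition radon (f : R * R -> R) : 'I_Q -> R -> R := fun q s =>
  \int[leb]_t (f \_ Omega) (s *: theta (phi q) + t *: theta_perp (phi q)).

End Radon.

Section Discretization.
Context {R : realType}.

Definition offset (ds : R) (P p : nat) : R :=
  ds * (p%:R - (P.+1)%:R / 2).

Definition offset_cell (ds : R) (P p : nat) : set R :=
  `[offset ds P p - ds / 2, offset ds P p + ds / 2[%classic.

Definition pixel_center (dx : R) (N M i j : nat) : R * R :=
  dx *: (i%:R - (N.+1)%:R / 2, j%:R - (M.+1)%:R / 2).

Definition pixel (dx : R) (N M i j : nat) : set (R * R) :=
  let c := pixel_center dx N M i j in
  `[c.1 - dx / 2, c.1 + dx / 2[%classic `*`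
  `[c.2 - dx / 2, c.2 + dx / 2[%classic.

Record discretization := Discretization {
  nP : nat;
  nN : nat;
  nM : nat;
  delta_s : R;
  delta_x : R;
  delta_s_gt0 : 0 < delta_s;
  delta_x_gt0 : 0 < delta_x;
  offset_cover :
    offsets `<=` [set s | exists p, [/\ (1 <= p)%N, (p <= nP)%N &
                                        offset_cell delta_s nP p s]];
  pixel_cover :
    Omega `<=` [set x | exists i j, [/\ (1 <= i)%N, (i <= nN)%N,
                                        (1 <= j)%N, (j <= nM)%N &
                                        pixel delta_x nN nM i j x]] }.

Definition hat (ds t : R) : R := Num.max 0 (ds - `|t|).

Definition discrete_radon (Q : nat) (phi : 'I_Q -> R) (D : discretization)
    (f : R * R -> R) : 'I_Q -> R -> R := fun q s =>
  let ds := delta_s D in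
  (ds ^+ 2)^-1 *
  \sum_(1 <= p < (nP D).+1) \1_(offset_cell ds (nP D) p) s *
    \sum_(1 <= i < (nN D).+1) \sum_(1 <= j < (nM D).+1)
      hat ds (dotp (pixel_center (delta_x D) (nN D) (nM D) i j) (theta (phi q))
              - offset ds (nP D) p) *
      \int[leb2]_(x in pixel (delta_x D) (nN D) (nM D) i j) (f \_ Omega) x.

End Discretization.

(* Main.v *)
Require Import Defs.
From HB Require Import structures.
From mathcomp Require Import all_boot all_order all_algebra.
From mathcomp Require Import all_classical all_reals all_analysis.
From mathcomp Require Import measurable_realfun.
From mathcomp Require Import zify ring lra.

Set Implicit Arguments.
Unset Strict Implicit.
Unset Printing Implicit Defensive.

Import Order.TTheory GRing.Theory Num.Theory.
Import numFieldNormedType.Exports.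

Local Open Scope classical_set_scope.
Local Open Scope ring_scope.

(* Composing with a rotation, f |-> R f(., phi_q) integrates f over the second
   coordinate, so everything reduces to kernels in one variable.

   Let all integers, and not only 1, ..., P, index the cells, and let c(s),
   pi(x) be the centers of the offset cell of s and of the pixel of x.  On
   ]-1, 1[ the discrete transform is the integral of f against
   K(x, s) = ds^-2 hat(pi(x).theta - c(s)).  The kernel K(x, .) is supported in
   |s - x.theta| <= 3 ds as soon as dx <= ds, is at most 1/ds, and has integral
   exactly 1, because the hats centered at all cell centers form a partition of
   unity.  Hence the adjoint error at x is an average of
   g(x.theta) - g(s) over a window of size O(ds), with square integral
   O(sup_{|h| <= 3 ds} omega_g(h,0)^2); there the pixel width only matters
   through dx <= ds, and extending g by zero takes care of the boundary.  For
   the forward error, first replace pi(x) by x: the kernel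
   ds^-2 hat(x.theta - c(s)) yields a weighted average of R f around s, hence an
   error O(sup omega_{Rf}), and the replacement costs O(dx / ds) ||f|| since hat
   is 1-Lipschitz.  It remains to see that omega(h, 0) -> 0 for every L^2
   sinogram, by truncation and density of continuous functions in L^1. *)

(** * Translations and rotations *)

(** The two errors are treated differently because pi(x).theta is not a function of x.theta. For the
    adjoint, x is fixed and the hats sum to one around any point, so rounding x to pi(x) merely
    widens the window. For the forward error, x is integrated, and a kernel in pi(x) cannot be
    expressed through line integrals of f; this forces the replacement of pi(x) by x. With the full
    norm of f at each s, that replacement would only be bounded by dx / ds^(3/2). But each s sees f
    only in a strip of width O(ds), and keeping this local mass until the integration over s gains
    the missing factor sqrt(ds). Under dx = O(ds^(1+eps)) the resulting dx / ds is O(ds^eps).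

    [adjoint] is chosen among all representatives and has no formula of its own. Sums of
    backprojections over the angles are shown to satisfy its defining property, and the estimate of
    their distance is carried over to the chosen functions by inner products alone. *)

Section measurable_plane.
Context {R : realType}.
Local Notation RR := (measurableTypeR R * measurableTypeR R)%type.

Lemma measurable_fun_plane d (X : measurableType d) (f g : X -> R) :
  measurable_fun setT f -> measurable_fun setT g ->
  measurable_fun setT (fun x => (f x, g x) : RR).
Proof.
exact: (@measurable_fun_pair _ _ _ _ (measurableTypeR R) (measurableTypeR R)).
Qed.

Lemma measurable_plane1 : measurable_fun setT (fst : RR -> R).
Proof. exact: measurable_fst. Qed.

Lemma measurable_plane2 : measurable_fun setT (snd : RR -> R).
Proof. exact: measurable_snd. Qed.

End measurable_plane.
#[local] Hint Resolve measurable_plane1 measurable_plane2 : core.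

Section translation.
Context {R : realType}.
Local Notation mu := (@lebesgue_measure R).

(** The translated measure agrees with Lebesgue measure on half-open intervals, and uniqueness
    extends this to all Borel sets. *)
Lemma lebesgue_measureD (a : R) (A : set R) : measurable A ->
  mu ((fun x => x + a) @^-1` A) = mu A.
Proof.
move=> mA.
have ma : measurable_fun [set: measurableTypeR R]
    (fun x : measurableTypeR R => x + a : measurableTypeR R).
  exact: measurable_funD.
rewrite -[LHS]/(pushforward mu
  (fun x : measurableTypeR R => x + a : measurableTypeR R) A).
apply/esym/lebesgue_measure_unique => //= _ [[b c]] _ <-.
rewrite /pushforward.
have -> : (fun x => x + a) @^-1` `]b, c]%classic = `]b - a, c - a]%classic.
  by apply/seteqP; split => x /=; rewrite !in_itv/= ltrBlDr lerBrDr.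
rewrite !lebesgue_measure_itv/= !lte_fin ltrD2r -!EFinB.
by have -> : c - a - (b - a) = c - b by ring.
Qed.

Lemma ge0_integralD_shift (a : R) (f : R -> \bar R) :
  measurable_fun [set: R] f -> (forall x, 0 <= f x)%E ->
  (\int[mu]_x f (x + a)%R = \int[mu]_x f x)%E.
Proof.
move=> mf f0.
have ma : measurable_fun [set: measurableTypeR R]
    (fun x : measurableTypeR R => x + a : measurableTypeR R).
  exact: measurable_funD.
rewrite -[LHS](@ge0_integral_pushforward _ _ _ _ _ _ ma mu setT f)//.
by apply: eq_measure_integral => //= A mA _; exact: lebesgue_measureD.
Qed.

End translation.
Section rotation.
Context {R : realType}.
Local Notation mu := (@lebesgue_measure R).
Local Notation T := (measurableTypeR R * measurableTypeR R)%type.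
Local Notation mu2 := (mu \x mu)%E.

Definition preserves_area (s : T -> T) := measurable_fun setT s /\
  forall A, measurable A -> mu2 (s @^-1` A) = mu2 A.

Lemma preserves_area_comp s t : preserves_area s -> preserves_area t ->
  preserves_area (s \o t).
Proof.
move=> [ms sE] [mt tE]; split; first exact: measurableT_comp.
move=> A mA; rewrite comp_preimage tE ?sE//.
by rewrite -[X in measurable X]setTI; exact: ms.
Qed.

(** On a vertical section the map is a translation by the fixed amount [h x.1], so every section
    keeps its length. *)
Lemma preserves_area_vert (h : R -> R) : measurable_fun setT h ->
  preserves_area (fun x => (x.1, x.2 + h x.1)).
Proof.
move=> mh.
have ms : measurable_fun setT (fun x : T => (x.1, x.2 + h x.1) : T).
  apply: measurable_fun_plane => //; apply: measurable_funD => //.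
  exact: measurableT_comp mh measurable_plane1.
split=> // A mA; rewrite /product_measure1.
apply: eq_integral => x _ /=; rewrite -[RHS](lebesgue_measureD (h x)).
  by congr mu; apply/seteqP; split => y; rewrite /xsection/= !inE.
exact: measurable_xsection.
Qed.

(** Both iterated constructions agree on rectangles. This carries the coordinate swap, and with it
    the horizontal shears. *)
Lemma product_measureE (A : set T) : measurable A -> mu2 A = (mu \x^ mu)%E A.
Proof.
move=> mA; apply: product_measure_unique => // B C mB mC.
exact: product_measure2E.
Qed.

Lemma preserves_area_swap : preserves_area (fun x => (x.2, x.1)).
Proof.
have ms : measurable_fun setT (fun x : T => (x.2, x.1) : T).
  exact: measurable_fun_plane.
split=> // A mA; rewrite [RHS]product_measureE//.
Qed.

Lemma preserves_area_opp2 : preserves_area (fun x => (x.1, - x.2)).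
Proof.
have ms : measurable_fun setT (fun x : T => (x.1, - x.2) : T).
  apply: measurable_fun_plane => //; exact: measurable_funN.
split=> // A mA; rewrite /product_measure1.
apply: eq_integral => x _ /=; rewrite -[RHS]lebesgue_measureN.
  by congr mu; apply/seteqP; split => y; rewrite /xsection/= !inE.
exact: measurable_xsection.
Qed.

(* A rotation whose sine is nonzero is a product of three shears. *)
Lemma preserves_area_rot (c d : R) : c ^+ 2 + d ^+ 2 = 1 ->
  preserves_area (fun x => (x.1 * c - x.2 * d, x.1 * d + x.2 * c)).
Proof.
move=> cd.
have vert a : preserves_area (fun x : T => (x.1, x.2 + a * x.1)).
  by apply: (@preserves_area_vert (fun u => a * u)); exact: measurable_funM.
have horiz a : preserves_area (fun x : T => (x.1 + a * x.2, x.2)).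
  exact: (preserves_area_comp preserves_area_swap
           (preserves_area_comp (vert a) preserves_area_swap)).
(* With zero sine the map is the identity or the half-turn, the latter a product of two
   reflections. *)
have [d0|d0] := eqVneq d 0.
  have opp1 : preserves_area (fun x : T => (- x.1, x.2)).
    exact: (preserves_area_comp preserves_area_swap
           (preserves_area_comp preserves_area_opp2 preserves_area_swap)).
  move: cd; rewrite d0 expr0n addr0 => /eqP; rewrite sqrf_eq1 => /orP[|] /eqP ->.
    rewrite [X in preserves_area X](_ : _ = (fun x : T => (x.1, x.2 + 0 * x.1)))//.
    by apply/funext => x; rewrite !mulr0 mul0r subr0 add0r !mulr1 addr0.
  rewrite [X in preserves_area X](_ : _ =
    (fun x : T => (x.1, - x.2)) \o (fun x : T => (- x.1, x.2))).
    exact: preserves_area_comp preserves_area_opp2 opp1.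
  by apply/funext => x /=; rewrite !mulr0 subr0 add0r !mulrN1.
(* For the angle t this is - tan (t / 2), the factor of the two horizontal shears on either side of
   a vertical shear by sin t. *)
set a := (c - 1) / d.
rewrite [X in preserves_area X](_ : _ = (fun x : T => (x.1 + a * x.2, x.2)) \o
    ((fun x : T => (x.1, x.2 + d * x.1)) \o (fun x : T => (x.1 + a * x.2, x.2)))).
  exact: preserves_area_comp (horiz _) (preserves_area_comp (vert _) (horiz _)).
have ad : a * d = c - 1 by rewrite /a divfK.
have a2 : a * (1 + c) = - d.
  apply: (mulIf d0); rewrite mulrAC ad; lra.
apply/funext => x /=; congr (_, _).
  have -> : x.1 + a * x.2 + a * (x.2 + d * (x.1 + a * x.2)) =
    x.1 * (1 + a * d) + x.2 * (a + a * (1 + a * d)) by ring.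
  rewrite ad; have -> : a + a * (1 + (c - 1)) = a * (1 + c) by ring.
  by rewrite a2; ring.
have -> : x.2 + d * (x.1 + a * x.2) = x.1 * d + x.2 * (1 + a * d) by ring.
by rewrite ad; ring.
Qed.

Lemma ge0_integral_preserves_area s (H : T -> \bar R) : preserves_area s ->
  measurable_fun setT H -> (forall x, 0 <= H x)%E ->
  (\int[mu2]_x H (s x) = \int[mu2]_x H x)%E.
Proof.
move=> [ms sE] mH H0.
have := @ge0_integral_pushforward _ _ _ _ _ _ ms mu2 setT H measurableT mH
  (fun x _ => H0 x).
rewrite preimage_setT => <-.
by apply: eq_measure_integral => A mA _; exact: sE.
Qed.

Lemma integral_preserves_area s (H : T -> \bar R) : preserves_area s ->
  mu2.-integrable setT H ->
  mu2.-integrable setT (H \o s) /\ (\int[mu2]_x H (s x) = \int[mu2]_x H x)%E.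
Proof.
move=> sP; have [ms sE] := sP; move=> iH; have mH := measurable_int _ iH.
have iHs : mu2.-integrable setT (H \o s).
  apply/integrableP; split; first exact: measurableT_comp.
  rewrite (ge0_integral_preserves_area (H := fun x => `|H x|%E) sP)//.
  - by case/integrableP : iH.
  - exact: measurableT_comp.
split=> //.
have := @integral_pushforward _ _ _ _ _ _ ms mu2 setT H mH.
rewrite preimage_setT => /(_ iHs measurableT) <-.
by apply: eq_measure_integral => A mA _; exact: sE.
Qed.

End rotation.

(** * Averages over windows and continuity of translations *)

(* Cauchy-Schwarz with a lower bound a for the integral of |v|; integrate
   2 a |v| <= a^2 / m + m v^2. *)
Lemma sqr_le_integral_sqr d (X : measurableType d) (R : realType)
    (mu : {measure set X -> \bar R}) (E : set X) (m : R) (v : X -> R) (a : R) :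
  measurable E -> 0 < m -> (mu E <= m%:E)%E -> measurable_fun E v ->
  0 <= a -> (a%:E <= \int[mu]_(x in E) `|v x|%:E)%E ->
  ((a ^+ 2)%:E <= m%:E * \int[mu]_(x in E) (v x ^+ 2)%:E)%E.
Proof.
move=> mE m0 muE mv a0 av.
have mav : measurable_fun E (fun x => `|v x|) by exact: measurableT_comp.
have mv2 : measurable_fun E (fun x => v x ^+ 2) by exact: measurable_funX.
have V0 : (0 <= \int[mu]_(x in E) (v x ^+ 2)%:E)%E.
  by apply: integral_ge0 => x _; rewrite lee_fin sqr_ge0.
have H : ((a * a)%:E <= (a ^+ 2 / 2)%:E + (m / 2)%:E * \int[mu]_(x in E) (v x ^+ 2)%:E)%E.
  apply: (@le_trans _ _ (\int[mu]_(x in E) (a ^+ 2 / (2 * m) + m / 2 * v x ^+ 2)%:E)%E).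
    rewrite EFinM; apply: (le_trans (lee_pmul _ _ (lexx a%:E) av)); rewrite ?lee_fin//.
    rewrite -ge0_integralZl//; last by apply/measurable_EFinP.
    apply: ge0_le_integral => //.
    - by move=> x _; rewrite lee_fin mulr_ge0.
    - by apply/measurable_EFinP; exact: measurable_funM.
    - apply/measurable_EFinP; apply: measurable_funD => //; exact: measurable_funM.
    - move=> x _; rewrite lee_fin -subr_ge0.
      rewrite (_ : _ - _ = (a - m * `|v x|) ^+ 2 / (2 * m)).
        by rewrite divr_ge0 ?sqr_ge0// mulr_ge0// ltW.
      rewrite -(real_normK (num_real (v x))).
      by field; rewrite gt_eqF.
  under eq_integral do rewrite EFinD.
  rewrite ge0_integralD//; first last.
  - by apply/measurable_EFinP; exact: measurable_funM.
  - by move=> x _; rewrite lee_fin mulr_ge0 ?sqr_ge0// divr_ge0// ltW.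
  - by move=> x _; rewrite lee_fin divr_ge0 ?sqr_ge0// mulr_ge0// ltW.
  apply: leeD.
    rewrite integral_cst//.
    rewrite (_ : a ^+ 2 / 2 = a ^+ 2 / (2 * m) * m); last by field; rewrite gt_eqF.
    by rewrite [leRHS]EFinM lee_pmul// lee_fin divr_ge0 ?sqr_ge0// mulr_ge0// ltW.
  under eq_integral do rewrite EFinM.
  rewrite ge0_integralZl// ?lee_fin ?divr_ge0 ?(ltW m0)//.
  - exact/measurable_EFinP.
  - by move=> x _; rewrite lee_fin sqr_ge0.
case: (\int[mu]_(x in E) (v x ^+ 2)%:E)%E V0 H => [V| |]//=.
- rewrite -!EFinM -EFinD !lee_fin => V0 H; lra.
- by move=> _ _; rewrite gt0_muley ?leey// lte_fin.
Qed.

Section square_modulus.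
Context {R : realType}.
Local Notation mu := (@lebesgue_measure R).
Local Notation RR := (measurableTypeR R * measurableTypeR R)%type.

Lemma lebesgue_measure_itvcc_radius (c r : R) : 0 <= r ->
  mu `[c - r, c + r]%classic = (2 * r)%:E.
Proof.
move=> r0; rewrite lebesgue_measure_itv/= lte_fin.
case: ifPn => [_|]; first by rewrite -EFinB; congr EFin; ring.
by rewrite -leNgt => ?; congr EFin; lra.
Qed.

Section window.
Variables (G : R -> R) (r : R).
Hypotheses (r0 : 0 <= r) (mG : measurable_fun setT G).

Let E : set R := `[(- r), r]%classic.

Let mE : measurable E. Proof. exact: measurable_itv. Qed.

Let K (x : RR) : \bar R := (\1_E x.2 * (G (x.1 + x.2) - G x.1) ^+ 2)%:E.

Let K0 x : (0 <= K x)%E. Proof. by rewrite lee_fin mulr_ge0 ?sqr_ge0. Qed.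

Let mK : measurable_fun setT K.
Proof.
apply/measurable_EFinP; apply: measurable_funM.
  exact: measurableT_comp (measurable_indic mE) measurable_plane2.
apply: measurable_funX; apply: measurable_funB.
  by apply: measurableT_comp mG _; exact: measurable_funD.
exact: measurableT_comp mG measurable_plane1.
Qed.

(** Substituting s = u + h turns the window moving with u into the fixed set [E], so that the double
    integral runs over a product. *)
Let windowE (u : R) :
  (\int[mu]_(s in `[(u - r)%R, (u + r)%R]) ((G u - G s) ^+ 2)%:E =
   \int[mu]_h K (u, h))%E.
Proof.
have Eu (h : R) : (h + u \in `[u - r, u + r]%classic) = (h \in E).
  by apply/idP/idP; rewrite !inE /E/= !in_itv/= => /andP[? ?]; apply/andP; split; lra.
rewrite integral_mkcond.
rewrite -[LHS](ge0_integralD_shift u)//; last 2 first.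
- apply: (measurable_restrictT _ (measurable_itv _)).1; apply/measurable_EFinP.
  apply: measurable_funTS; apply: measurable_funX; exact: measurable_funB.
- by move=> x; rewrite patchE; case: ifP => // _; rewrite lee_fin sqr_ge0.
apply: eq_integral => h _; rewrite patchE /K indicE/=.
rewrite Eu; case: ifP => _; rewrite ?mul0r ?mul1r//.
by rewrite -sqrrN opprB [(h + u)%R]addrC.
Qed.

Lemma measurable_integral_sqrB : measurable_fun setT (fun u : R =>
  \int[mu]_(s in `[(u - r)%R, (u + r)%R]) ((G u - G s) ^+ 2)%:E)%E.
Proof.
under eq_fun do rewrite windowE.
exact: (measurable_fun_fubini_tonelli_F K).
Qed.

(** Exchanging the integrals leaves, for each shift h in a window of length 2 r, the squared modulus
    of continuity at h. *)
Lemma integral_sqrB_le (M : R) :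
  (forall h, `|h| <= r -> (\int[mu]_s ((G (s + h) - G s) ^+ 2)%:E <= M%:E)%E) ->
  (\int[mu]_u \int[mu]_(s in `[(u - r)%R, (u + r)%R]) ((G u - G s) ^+ 2)%:E
    <= (2 * r * M)%:E)%E.
Proof.
move=> GM.
under eq_integral do rewrite windowE.
rewrite (fubini_tonelli K)//.
apply: (@le_trans _ _ (\int[mu]_h (\1_E h * M)%:E)%E).
  apply: ge0_le_integral => //.
  - by move=> h _; exact: integral_ge0.
  - exact: (measurable_fun_fubini_tonelli_G K).
  - by apply/measurable_EFinP; apply: measurable_funM.
  - move=> h _; rewrite /K/= indicE; have [hE|hE] := boolP (h \in E).
      under eq_integral do rewrite mul1r.
      rewrite mul1r; apply: GM; rewrite ler_norml.
      by move/set_mem: hE; rewrite /E/= in_itv.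
    under eq_integral do rewrite mul0r.
    by rewrite integral0 mul0r.
under eq_integral do rewrite EFinM muleC.
have M0 : 0 <= M.
  rewrite -lee_fin; apply: le_trans (GM 0 _); rewrite ?normr0//.
  by apply: integral_ge0 => x _; rewrite lee_fin sqr_ge0.
rewrite ge0_integralZl//; last by apply/measurable_EFinP.
rewrite integral_indic// setIT.
have muE : mu E = (2 * r)%:E.
  by rewrite -(lebesgue_measure_itvcc_radius 0 r0) !add0r.
by rewrite mulrC EFinM -muE.
Qed.

End window.

End square_modulus.

Section translation_continuity.
Context {R : realType}.
Local Notation mu := (@lebesgue_measure R).

(** Compactness of the segment, used as a near-covering property, makes one neighbourhood of shifts
    serve every s at once. *)
Lemma unif_continuous_translation (g : R -> R) (a b e : R) :
  continuous g -> 0 < e ->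
  \forall h \near (0 : R), forall s, a <= s <= b -> `|g (s + h) - g s| <= e.
Proof.
move=> cg e0.
have /compact_near_coveringP cov := @segment_compact R a b.
have : \forall h \near (0 : R), `[a, b]%classic `<=` (fun s => `|g (s + h) - g s| <= e).
  apply: (cov _ (nbhs (0 : R)) (fun h s => `|g (s + h) - g s| <= e)) => s sab.
  have e2 : 0 < e / 2 by rewrite divr_gt0.
  have c1 : \forall p \near (s, (0:R)), `|g s - g (p.1 + p.2)| < e / 2.
    have : (fun p : R * R => g (p.1 + p.2)) @ (s, 0) --> g (s + 0).
      apply: continuous_comp; last exact: cg.
      by apply: (@cvgD _ R); [exact: cvg_fst | exact: cvg_snd].
    by rewrite addr0 => /cvgrPdist_lt; exact.
  have c2 : \forall p \near (s, (0:R)), `|g s - g p.1| < e / 2.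
    have : (fun p : R * R => g p.1) @ (s, 0) --> g s.
      by apply: continuous_comp; [exact: cvg_fst | exact: cg].
    by move/cvgrPdist_lt; exact.
  near=> p.
  have H1 : `|g s - g (p.1 + p.2)| < e / 2 by near: p.
  have H2 : `|g s - g p.1| < e / 2 by near: p.
  rewrite /= [leLHS](_ : _ = `|(g s - g p.1) - (g s - g (p.1 + p.2))|).
    by rewrite (le_trans (ler_normB _ _))// [e]splitr lerD// ltW.
  by congr (`|_|); ring.
by apply: filterS => h H s sab; apply: H; rewrite /= in_itv.
Unshelve. all: by end_near. Qed.

Lemma translation_cvg_L1 (T : R -> R) (N : R) : measurable_fun setT T ->
  (forall s, `|T s| <= N) -> (forall s, 1 <= `|s| -> T s = 0) ->
  forall e, 0 < e ->
  \forall h \near (0 : R), (\int[mu]_s `|T (s + h) - T s|%:E <= e%:E)%E.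
Proof.
move=> mT TN T0 e e0.
(* For shifts of size at most 1: if s lies in [B], then s and s + h lie in [E], where a continuous
   function approximates [T]; if not, [T] vanishes at both. *)
pose E : set R := `[-3, 3]%classic.
pose B : set R := `[-2, 2]%classic.
have mE : measurable E by exact: measurable_itv.
have mB : measurable B by exact: measurable_itv.
have muB : mu B = 4%:E.
  have := @lebesgue_measure_itvcc_radius R 0 2 (ler0n R 2).
  by rewrite !add0r -natrM.
have muE : (mu E < +oo)%E.
  have := @lebesgue_measure_itvcc_radius R 0 3 (ler0n R 3).
  by rewrite !add0r => ->; rewrite ltry.
have iT : mu.-integrable E (EFin \o T).
  apply: measurable_bounded_integrable => //; first exact: measurable_funTS.
  exists N; split; first exact: num_real.
  by move=> M NM s _; exact: le_trans (TN s) (ltW NM).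
have [g_ [cg _ g_T]] := approximation_continuous_integrable mE muE iT.
(* The budget is e / 4 for each of the two approximation errors, and e / 8 times the length 4 of [B]
   for the continuous function. *)
have e4 : 0 < e / 4 by rewrite divr_gt0.
have [n ge] : exists n, (\int[mu]_(z in E) `|(T z - g_ n z)%:E| < (e / 4)%:E)%E.
  have e4' : (0 < (e / 4)%:E)%E by rewrite lte_fin.
  by have [n _ /(_ n (leqnn n)) ?] := g_T _ (open_ereal_lt' e4'); exists n.
have mg : measurable_fun setT (g_ n) by exact: continuous_measurable_fun.
(* The approximant is not controlled off [E]. Cutting the error to [E] gives a function on the whole
   line, whose integral a shift preserves. *)
pose u s := \1_E s * `|T s - g_ n s|.
have mu_ : measurable_fun setT u.
  apply: measurable_funM; first exact: measurable_indic.
  by apply: measurableT_comp => //; exact: measurable_funB.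
have ue : (\int[mu]_s (u s)%:E <= (e / 4)%:E)%E.
  apply: le_trans (ltW ge); rewrite [leRHS]integral_mkcond le_eqVlt; apply/orP; left.
  apply/eqP; apply: eq_integral => s _; rewrite patchE /u indicE.
  by case: (s \in E); rewrite ?mul1r ?mul0r.
near=> h.
have h1 : `|h| <= 1.
  near: h; exact: (@nbhs0_le R R 1 ltr01).
have hg : forall s, -2 <= s <= 2 -> `|g_ n (s + h) - g_ n s| <= e / 8.
  near: h; apply: unif_continuous_translation => //; exact: divr_gt0.
have muh : measurable_fun setT (fun s : R => u (s + h)).
  by apply: measurableT_comp mu_ _; exact: measurable_funD.
apply: (@le_trans _ _ (\int[mu]_s ((u (s + h))%:E + (\1_B s * (e / 8))%:E + (u s)%:E))%E).
  apply: ge0_le_integral => //.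
  - apply/measurable_EFinP; apply: measurableT_comp => //.
    apply: measurable_funB => //.
    by apply: measurableT_comp mT _; exact: measurable_funD.
  - apply: emeasurable_funD; last exact/measurable_EFinP.
    apply: emeasurable_funD; first exact/measurable_EFinP.
    by apply/measurable_EFinP; apply: measurable_funM => //; exact: measurable_indic.
  move=> s _; rewrite -!EFinD lee_fin.
  have u0 t : 0 <= u t by rewrite mulr_ge0.
  have [sB|sB] := boolP (s \in B).
    rewrite indicE sB mul1r /u !indicE.
    have sB' : -2 <= s <= 2 by move/set_mem: sB; rewrite /B/= in_itv.
    have /andP[s1 s2] := sB'.
    have /andP[h2 h3] : -1 <= h <= 1 by rewrite -ler_norml.
    rewrite !mem_set; [|rewrite /E/= in_itv/=; apply/andP; split; lra..].
    rewrite !mul1r.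
    have -> : T (s + h) - T s = (T (s + h) - g_ n (s + h)) +
      (g_ n (s + h) - g_ n s) - (T s - g_ n s) by ring.
    apply: le_trans (ler_normB _ _) _; rewrite lerD2r.
    by apply: le_trans (ler_normD _ _) _; rewrite lerD2l hg.
  have s2 : 2 < `|s|.
    rewrite ltNge ler_norml; apply: contra sB => sB.
    by apply: mem_set; rewrite /B/= in_itv.
  rewrite !T0 ?subrr ?normr0 ?addr_ge0 ?mulr_ge0 ?u0 ?(ltW e0)//; first lra.
  have := lerB_normD s h; lra.
have u0 t : (0 <= (u t)%:E)%E by rewrite lee_fin mulr_ge0.
rewrite ge0_integralD//; first last.
- exact/measurable_EFinP.
- apply: emeasurable_funD; first exact/measurable_EFinP.
  by apply/measurable_EFinP; apply: measurable_funM => //; exact: measurable_indic.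
- by move=> s _; rewrite adde_ge0// lee_fin mulr_ge0// divr_ge0// ltW.
rewrite ge0_integralD//; first last.
- by apply/measurable_EFinP; apply: measurable_funM => //; exact: measurable_indic.
- by move=> s _; rewrite lee_fin mulr_ge0// divr_ge0// ltW.
- exact/measurable_EFinP.
rewrite (ge0_integralD_shift h (f := EFin \o u))//; last exact/measurable_EFinP.
have -> : (\int[mu]_x (\1_B x * (e / 8))%:E = (e / 2)%:E)%E.
  under eq_integral do rewrite mulrC EFinM.
  rewrite ge0_integralZl ?lee_fin ?divr_ge0 ?(ltW e0)//; last first.
    by apply/measurable_EFinP; exact: measurable_indic.
  rewrite integral_indic// setIT.
  have -> : e / 2 = e / 8 * 4 by field.
  by rewrite [RHS]EFinM -muB.
apply: le_trans (leeD (leeD ue (lexx _)) ue) _.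
by rewrite -!EFinD lee_fin; lra.
Unshelve. all: by end_near. Qed.

(** Differences of the truncation at height n + 1 are at most 2 (n + 1), so their squares are
    controlled by the L^1 case; the part cut off is small in L^2 by dominated convergence. The level
    n is fixed before h. *)
Lemma translation_cvg_L2 (G : R -> R) : measurable_fun setT G ->
  (\int[mu]_s (G s ^+ 2)%:E < +oo)%E -> (forall s, 1 <= `|s| -> G s = 0) ->
  forall e, 0 < e ->
  \forall h \near (0 : R), (\int[mu]_s ((G (s + h) - G s) ^+ 2)%:E <= e%:E)%E.
Proof.
move=> mG G2 G0 e e0.
pose T n s := Num.max (- n.+1%:R) (Num.min n.+1%:R (G s)).
have mT n : measurable_fun setT (T n).
  by apply: measurable_maxr => //; exact: measurable_minr.
have TG n s : `|G s| <= n.+1%:R -> T n s = G s.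
  by rewrite ler_norml => /andP[? ?]; rewrite /T min_r// max_r.
have TN n s : `|T n s| <= n.+1%:R.
  rewrite /T ler_norml le_max lexx/= ge_max ge_min lexx/= andbT.
  by rewrite (@le_trans _ _ 0)// oppr_le0.
have GT n s : `|G s - T n s| <= `|G s|.
  rewrite /T; have n0 : 0 <= n.+1%:R :> R by [].
  have [? | ?] := leP n.+1%:R (G s); have [? | ?] := leP (- n.+1%:R) _.
  - by rewrite !ger0_norm; lra.
  - lra.
  - by rewrite subrr normr0.
  - by rewrite !ler0_norm; lra.
have mG2 : measurable_fun setT (fun s => (G s ^+ 2)%:E).
  by apply/measurable_EFinP; exact: measurable_funX.
have mGT n : measurable_fun setT (fun s => ((G s - T n s) ^+ 2)%:E).
  by apply/measurable_EFinP; apply: measurable_funX; exact: measurable_funB.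
have iG2 : mu.-integrable setT (fun s => (G s ^+ 2)%:E).
  apply/integrableP; split => //.
  by under eq_integral do rewrite gee0_abs ?lee_fin ?sqr_ge0//.
have cvgT : (\int[mu]_s ((G s - T n s) ^+ 2)%:E)%E @[n --> \oo] --> 0%E.
  have c1 : {ae mu, forall s, [set: R] s ->
      ((G s - T n s) ^+ 2)%:E @[n --> \oo] --> 0%E}.
    apply: aeW => s _; apply: cvg_near_cst.
    have [N GN] : exists N, `|G s| <= N%:R.
      by exists (Num.truncn `|G s|).+1; rewrite ltW// truncnS_gt.
    exists N => // n /= Nn; rewrite TG ?subrr ?expr0n//.
    by rewrite (le_trans GN)// ler_nat ltnW.
  have c2 : {ae mu, forall s n, [set: R] s ->
      (`|((G s - T n s) ^+ 2)%:E| <= (G s ^+ 2)%:E)%E}.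
    apply: aeW => s n _; rewrite gee0_abs ?lee_fin ?sqr_ge0//.
    rewrite -(real_normK (num_real (G s - _))) -(real_normK (num_real (G s))).
    by rewrite ler_sqr ?nnegrE.
  have [_ _] := @dominated_convergence _ _ _ mu setT measurableT _ (cst 0%E) _
    mGT (measurable_cst _) c1 iG2 c2.
  by rewrite integral0.
(* With (a + b - c)^2 <= 3 (a^2 + b^2 + c^2), the two cut-off parts contribute 3 e / 12 each, and
   the truncation contributes 6 (n + 1) times e / (12 (n + 1)); the sum is e. *)
have e12 : (0 < (e / 12)%:E)%E by rewrite lte_fin divr_gt0.
have [n _ /(_ n (leqnn n)) /= Te] := cvgT _ (open_ereal_lt' e12).
have T0 s : 1 <= `|s| -> T n s = 0.
  by move=> s1; rewrite TG G0// normr0.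
have e12n : 0 < e / (12 * n.+1%:R) by rewrite divr_gt0// mulr_gt0.
near=> h.
have Th : (\int[mu]_s `|T n (s + h) - T n s|%:E <= (e / (12 * n.+1%:R))%:E)%E.
  by near: h; exact: (translation_cvg_L1 (mT n) (TN n) T0 e12n).
have mD (H : R -> R) : measurable_fun setT H ->
    measurable_fun setT (fun s : R => H (s + h)).
  by move=> mH; apply: measurableT_comp mH _; exact: measurable_funD.
pose D s := (G s - T n s) ^+ 2.
have mD0 : measurable_fun setT D.
  by apply: measurable_funX; exact: measurable_funB.
pose L s := `|T n (s + h) - T n s|.
have mL : measurable_fun setT L.
  by apply: measurableT_comp => //; apply: measurable_funB => //; exact: mD.
have D0 s : (0 <= (D s)%:E)%E by rewrite lee_fin sqr_ge0.
have L0 s : (0 <= (L s)%:E)%E by rewrite lee_fin normr_ge0.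
have n3 : (0 <= 3%:E :> \bar R)%E by rewrite lee_fin.
have n6 : (0 <= (6 * n.+1%:R)%:E :> \bar R)%E by rewrite lee_fin.
have mDe : measurable_fun setT (EFin \o D) by exact/measurable_EFinP.
have mDhe : measurable_fun setT (fun s : R => (D (s + h))%:E).
  by apply/measurable_EFinP; exact: mD.
have mLe : measurable_fun setT (EFin \o L) by exact/measurable_EFinP.
apply: (@le_trans _ _ (\int[mu]_s (3%:E * (D (s + h))%:E +
    (6 * n.+1%:R)%:E * (L s)%:E + 3%:E * (D s)%:E))%E).
  apply: ge0_le_integral => //.
  - by move=> s _; rewrite lee_fin sqr_ge0.
  - apply/measurable_EFinP; apply: measurable_funX; apply: measurable_funB => //.
    exact: mD.
  - apply: emeasurable_funD; last exact: measurable_funeM mDe.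
    apply: emeasurable_funD; [exact: measurable_funeM mDhe|].
    exact: measurable_funeM mLe.
  move=> s _; rewrite -!EFinM -!EFinD lee_fin.
  have LN : L s ^+ 2 <= (2 * n.+1%:R) * L s.
    rewrite expr2; apply: ler_wpM2r; rewrite /L//.
    apply: le_trans (ler_normB _ _) _.
    by have := TN n (s + h); have := TN n s; lra.
  have -> : G (s + h) - G s = (G (s + h) - T n (s + h)) +
    (T n (s + h) - T n s) - (G s - T n s) by ring.
  have := real_normK (num_real (T n (s + h) - T n s)).
  rewrite -/(L s) /D => LE.
  move: LE LN; move: (G (s + h) - T n (s + h)) (T n (s + h) - T n s) (G s - T n s) (L s).
  move=> a b c l lb lN.
  have := sqr_ge0 (a - b); have := sqr_ge0 (a + c); have := sqr_ge0 (b + c); nra.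
rewrite ge0_integralD//; first last.
- exact: measurable_funeM.
- by move=> s _; rewrite mule_ge0.
- by apply: emeasurable_funD; exact: measurable_funeM.
- by move=> s _; rewrite adde_ge0// mule_ge0.
rewrite ge0_integralD//; first last.
- exact: measurable_funeM.
- by move=> s _; rewrite mule_ge0.
- exact: measurable_funeM.
- by move=> s _; rewrite mule_ge0.
rewrite !ge0_integralZl//.
rewrite (ge0_integralD_shift h (f := EFin \o D))//.
apply: (@le_trans _ _ (3%:E * (e / 12)%:E + (6 * n.+1%:R)%:E * (e / (12 * n.+1%:R))%:E
   + 3%:E * (e / 12)%:E)%E).
  by apply: leeD; [apply: leeD|]; apply: lee_pmul => //;
    (by apply: integral_ge0 => s _; (exact: D0 || exact: L0)) ||
    (exact: (ltW Te) || exact: Th).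
rewrite -!EFinM -!EFinD lee_fin [leLHS](_ : _ = e)//.
have : n.+1%:R != 0 :> R by rewrite pnatr_eq0.
by move: (n.+1%:R : R) => k k0; field.
Unshelve. all: by end_near. Qed.

End translation_continuity.

(** * Grid cells and hat functions *)

Lemma integral_indicT d (T : measurableType d) (R : realType)
    (mu : {measure set T -> \bar R}) (A : set T) : measurable A ->
  (\int[mu]_x (\1_A x)%:E = mu A)%E.
Proof. by move=> mA; rewrite integral_indic// setIT. Qed.

Lemma ge0_integral_scale_indic d (T : measurableType d) (R : realType)
    (mu : {measure set T -> \bar R}) (A : set T) (c : R) : 0 <= c -> measurable A ->
  (\int[mu]_x (c * \1_A x)%:E = c%:E * mu A)%E.
Proof.
move=> c0 mA; under eq_integral do rewrite EFinM.
rewrite ge0_integralZl//; last by apply/measurable_EFinP; exact: measurable_indic.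
by rewrite integral_indicT.
Qed.

Section cells.
Context {R : realType}.
Local Notation mu := (@lebesgue_measure R).
Implicit Types (d s t v c : R) (P p : nat).

(* The center of the cell containing s when the cells S_p are indexed by all
   integers p, so that every real lies in a cell. *)
Definition cell_index d P s : int := Num.floor (s / d + P%:R / 2).

Definition cell_center d P s : R :=
  d * ((cell_index d P s)%:~R + 2^-1 - P%:R / 2).

Lemma cell_indexP d P s (m : int) : 0 < d ->
  (cell_index d P s == m) =
  (s \in `[d * (m%:~R - P%:R / 2), d * (m%:~R + 1 - P%:R / 2)[).
Proof.
move=> d0; rewrite in_itv/=.
have E : s = d * (s / d) by rewrite mulrC divfK// gt_eqF.
rewrite [in RHS]E ler_pM2l// ltr_pM2l// lerBlDr ltrBrDr.
by rewrite /cell_index real_floor_eq ?num_real// intrD.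
Qed.

(** Offsets are numbered from 1, whereas [cell_index] is 0 on the cell that starts at the left end -
    d P / 2 of the grid. *)
Lemma offset_cell_index d P p s : 0 < d ->
  offset_cell d P p s = (cell_index d P s == p%:Z - 1) :> Prop.
Proof.
move=> d0; rewrite cell_indexP// /offset_cell /offset.
have -> : d * (p%:R - P.+1%:R / 2) - d / 2 = d * ((p%:Z - 1)%:~R - P%:R / 2).
  by rewrite intrB -pmulrn -addn1 natrD; field.
have -> : d * (p%:R - P.+1%:R / 2) + d / 2 = d * ((p%:Z - 1)%:~R + 1 - P%:R / 2).
  by rewrite intrB -pmulrn -addn1 natrD; field.
by [].
Qed.

Lemma cell_center_offset d P p s : 0 < d -> offset_cell d P p s ->
  cell_center d P s = offset d P p.
Proof.
move=> d0; rewrite offset_cell_index// => /eqP E.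
by rewrite /cell_center E /offset intrB -pmulrn -addn1 natrD; field.
Qed.

Lemma cell_center_dist d P s : 0 < d -> `|cell_center d P s - s| <= d / 2.
Proof.
move=> d0; have := cell_indexP P s (cell_index d P s) d0.
rewrite eqxx => /esym; rewrite in_itv/= => /andP[h1 h2].
by rewrite /cell_center ler_norml; apply/andP; split; nra.
Qed.

(** The cells are disjoint, so only the one containing s contributes, and the hypothesis says that
    it is among the P available ones. *)
Lemma sum_offset_cell d P s (h : R -> R) : 0 < d ->
  (exists p, [/\ (1 <= p)%N, (p <= P)%N & offset_cell d P p s]) ->
  \sum_(1 <= p < P.+1) \1_(offset_cell d P p) s * h (offset d P p) =
  h (cell_center d P s).
Proof.
move=> d0 [p [p1 pP sp]]; rewrite (bigD1_seq p) ?iota_uniq//=; last first.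
  by rewrite mem_index_iota p1.
rewrite indicE mem_set// mul1r (cell_center_offset d0 sp) big1 ?addr0// => i ip.
rewrite indicE memNset ?mul0r//; move: sp; rewrite !offset_cell_index//.
move=> /eqP -> /eqP E; move/eqP: ip; apply; apply/eqP.
by rewrite -eqz_nat; apply/eqP; move: E; lia.
Qed.

Lemma nondecreasing_cell_center d P : 0 < d ->
  {homo cell_center d P : s t / s <= t}.
Proof.
move=> d0 s t st; rewrite /cell_center ler_pM2l// lerD2r lerD2r ler_int.
by apply: le_floor; rewrite lerD2r ler_pM2r ?invr_gt0.
Qed.

Lemma measurable_cell_center d P : 0 < d -> measurable_fun setT (cell_center d P).
Proof.
move=> d0; apply: nondecreasing_measurable => //.
exact: nondecreasing_cell_center.
Qed.

Lemma hat_ge0 d t : 0 <= hat d t. Proof. by rewrite le_max lexx. Qed.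

Lemma hat_le d t : 0 <= d -> hat d t <= d.
Proof. by move=> d0; rewrite ge_max d0/= gerBl. Qed.

Lemma hat_eq0 d t : d <= `|t| -> hat d t = 0.
Proof. by move=> dt; apply: max_l; rewrite subr_le0. Qed.

Lemma hat_lip d s t : `|hat d s - hat d t| <= `|s - t|.
Proof.
have H a b : hat d a <= hat d b + `|a - b|.
  rewrite {1}/hat ge_max; apply/andP; split; first by rewrite addr_ge0// hat_ge0.
  apply: (@le_trans _ _ (d - `|b| + `|a - b|)).
    by have := lerB_dist b a; rewrite distrC; lra.
  by rewrite lerD2r /hat le_max lexx orbT.
rewrite ler_norml; apply/andP; split; last by have := H s t; lra.
by have := H t s; rewrite distrC; lra.
Qed.

Lemma measurable_hat d : measurable_fun setT (hat d).
Proof.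
apply: measurable_maxr => //; apply: measurable_funB => //.
Qed.

Lemma lebesgue_measure_cell d P (m : int) : 0 < d ->
  mu [set s | cell_index d P s == m] = d%:E.
Proof.
move=> d0; rewrite (_ : [set s | _] =
    `[d * (m%:~R - P%:R / 2), d * (m%:~R + 1 - P%:R / 2)[%classic); last first.
  by apply/seteqP; split => s /=; rewrite cell_indexP.
rewrite lebesgue_measure_itv/= lte_fin ltr_pM2l// ltrD2r ltrDl ltr01.
by rewrite -EFinB; congr EFin; ring.
Qed.

Lemma measurable_cell d P (m : int) : 0 < d ->
  measurable [set s | cell_index d P s == m].
Proof.
move=> d0; rewrite (_ : [set s | _] =
    `[d * (m%:~R - P%:R / 2), d * (m%:~R + 1 - P%:R / 2)[%classic).
  exact: measurable_itv.
by apply/seteqP; split => s /=; rewrite cell_indexP.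
Qed.

(* Only the two cells whose centers surround v contribute. *)
Lemma integral_hat_cell_center d P v : 0 < d ->
  (\int[mu]_s (hat d (v - cell_center d P s))%:E = (d ^+ 2)%:E)%E.
Proof.
(* [n] is the last index whose center is at most v, and [f] in [0, 1[ is the position of v between
   the centers of [n] and [n + 1], in units of d. *)
move=> d0; pose n := Num.floor (v / d + P%:R / 2 - 2^-1).
pose f := v / d + P%:R / 2 - 2^-1 - n%:~R.
have f0 : 0 <= f by rewrite subr_ge0 floor_le.
have f1 : f < 1 by have := floorD1_gt (v / d + P%:R / 2 - 2^-1); rewrite intrD -/n /f; lra.
have vE : v = d * (n%:~R + f + 2^-1 - P%:R / 2).
  by rewrite /f; field; rewrite gt_eqF.
pose A m := [set s | cell_index d P s == m].
have mA m : measurable (A m) by exact: measurable_cell.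
(* The hat is d (1 - f) on cell [n] and d f on cell [n + 1]. These values add up to d, and each cell
   has length d. *)
rewrite (_ : (fun s => _) = (fun s =>
  (d * (1 - f) * \1_(A n) s)%:E + (d * f * \1_(A (n + 1)%R) s)%:E)%E); last first.
  apply/funext => s; rewrite -EFinD; congr EFin.
  rewrite !indicE /cell_center [in LHS]vE.
  set a := cell_index d P s.
  have -> : d * (n%:~R + f + 2^-1 - P%:R / 2) - d * (a%:~R + 2^-1 - P%:R / 2) =
    d * (n%:~R + f - a%:~R) by ring.
  have [an|an] := eqVneq a n.
    rewrite mem_set; last exact/eqP.
    rewrite memNset; last by rewrite /A /= -/a an => /eqP; lia.
    rewrite an addrC addKr mulr0 addr0 mulr1 /hat ger0_norm ?mulr_ge0 ?(ltW d0)//.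
    by rewrite max_r; nra.
  rewrite (memNset (_ : ~ A n s)); last by rewrite /A /= -/a; exact/negP.
  rewrite mulr0 add0r; have [an1|an1] := eqVneq a (n + 1).
    rewrite mem_set; last exact/eqP.
    rewrite an1 mulr1 intrD /hat ler0_norm; last by nra.
    by rewrite max_r; nra.
  rewrite memNset; last by rewrite /A /= -/a; exact/negP.
  rewrite mulr0 hat_eq0// normrM gtr0_norm// ler_peMr ?(ltW d0)//.
  have [aln|nla] := ltP a n.
    have : a%:~R + 1 <= n%:~R :> R by rewrite -(intrD _ a 1) ler_int; lia.
    by move=> ?; rewrite ger0_norm; lra.
  have : n%:~R + 2 <= a%:~R :> R.
    by rewrite -(intrD _ n 2) ler_int; move/eqP: an; move/eqP: an1; lia.
  by move=> ?; rewrite ler0_norm; lra.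
have c1 : 0 <= d * (1 - f) by rewrite mulr_ge0 ?subr_ge0 ?(ltW d0) ?(ltW f1).
have c2 : 0 <= d * f by rewrite mulr_ge0 ?(ltW d0).
rewrite ge0_integralD//; last 4 first.
- by move=> s _; rewrite lee_fin mulr_ge0.
- by apply/measurable_EFinP; apply: measurable_funM => //; exact: measurable_indic (mA _).
- by move=> s _; rewrite lee_fin mulr_ge0.
- by apply/measurable_EFinP; apply: measurable_funM => //; exact: measurable_indic (mA _).
rewrite [X in (X + _)%E](_ : _ = (d * (1 - f) * d)%:E); last first.
  rewrite [RHS]EFinM -(lebesgue_measure_cell P n d0).
  exact: (@ge0_integral_scale_indic _ _ _ mu (A n) _ c1 (mA n)).
rewrite [X in (_ + X)%E](_ : _ = (d * f * d)%:E); last first.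
  rewrite [RHS]EFinM -(lebesgue_measure_cell P (n + 1) d0).
  exact: (@ge0_integral_scale_indic _ _ _ mu (A (n + 1)) _ c2 (mA (n + 1))).
by rewrite -EFinD; congr EFin; ring.
Qed.

(** Shifting the rising half of the hat by d puts it over the falling half, and the two add up to
    the constant d on [0, d[; this avoids a primitive. *)
Lemma integral_hat d c : 0 < d -> (\int[mu]_u (hat d (u - c))%:E = (d ^+ 2)%:E)%E.
Proof.
move=> d0.
rewrite (ge0_integralD_shift (- c) (f := fun u => (hat d u)%:E)); last 2 first.
- by apply/measurable_EFinP; exact: measurable_hat.
- by move=> u; rewrite lee_fin hat_ge0.
pose A : set R := `[0, d[%classic.
have mA : measurable A by exact: measurable_itv.
have mu1 : measurable_fun setT (fun u : R => (\1_A u * u)%:E).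
  by apply/measurable_EFinP; apply: measurable_funM => //; exact: measurable_indic.
have mu2 : measurable_fun setT (fun u : R => (\1_A u * (d - u))%:E).
  apply/measurable_EFinP; apply: measurable_funM; first exact: measurable_indic.
  exact: measurable_funB.
have p1 (u : R) : (0 <= (\1_A u * u)%:E)%E.
  rewrite lee_fin indicE; case: (boolP (u \in A)) => [/set_mem|]; last by rewrite mul0r.
  by rewrite /A/= in_itv/= mul1r => /andP[].
have p2 (u : R) : (0 <= (\1_A u * (d - u))%:E)%E.
  rewrite lee_fin indicE; case: (boolP (u \in A)) => [/set_mem|]; last by rewrite mul0r.
  by rewrite /A/= in_itv/= mul1r => /andP[_ /ltW]; rewrite subr_ge0.
have hatE (u : R) : hat d u = \1_A (u + d) * (u + d) + \1_A u * (d - u).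
  rewrite !indicE.
  have -> : (u + d \in A) = (- d <= u < 0).
    apply/idP/idP => [/set_mem|/andP[? ?]]; [|apply: mem_set];
      rewrite /A/= in_itv/=; last by apply/andP; split; lra.
    by move=> /andP[? ?]; apply/andP; split; lra.
  have -> : (u \in A) = (0 <= u < d).
    by apply/idP/idP => [/set_mem|?]; [|apply: mem_set]; rewrite /A/= in_itv/=.
  have [u0|u0] := ltP u 0.
    rewrite andbT mul0r addr0; have [du|du] := leP (- d) u.
      by rewrite mul1r /hat ltr0_norm// max_r; lra.
    by rewrite mul0r hat_eq0// ltr0_norm//; lra.
  rewrite andbF mul0r add0r /=; have [ud|ud] := ltP u d.
    by rewrite mul1r /hat ger0_norm// max_r; lra.
  by rewrite mul0r hat_eq0// ger0_norm//; lra.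
under eq_integral do rewrite hatE EFinD.
have mu1d : measurable_fun setT (fun u : R => (\1_A (u + d) * (u + d))%:E).
  apply: (measurableT_comp (f := fun u : R => (\1_A u * u)%:E)) => //.
  exact: measurable_funD.
rewrite ge0_integralD//.
rewrite (ge0_integralD_shift d (f := fun u => (\1_A u * u)%:E))//.
rewrite -ge0_integralD//.
rewrite (_ : (fun u => _) = (fun u => (d * \1_A u)%:E)); last first.
  by apply/funext => u; rewrite -EFinD -mulrDr addrC subrK mulrC.
have mA' : mu A = d%:E.
  by rewrite /A lebesgue_measure_itv/= lte_fin d0 oppr0 adde0.
rewrite expr2 [RHS]EFinM -{2}mA'.
exact: (ge0_integral_scale_indic _ (ltW d0)).
Qed.

End cells.

(** * Line integrals *)

Section L2_criteria.
Context d (T : measurableType d) (R : realType) (mu : {measure set T -> \bar R}).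
Implicit Types f g : T -> R.

Lemma Lnorm2E f :
  ('N[mu]_2%:E[EFin \o f] = (\int[mu]_x (f x ^+ 2)%:E) `^ 2^-1)%E.
Proof.
rewrite unlock /=; congr (_ `^ _)%E; apply: eq_integral => x _ /=.
by rewrite powR_mulrn// real_normK// num_real.
Qed.

Lemma Lfun2P f : f \in Lfun mu 2%:E <->
  measurable_fun setT f /\ (\int[mu]_x (f x ^+ 2)%:E < +oo)%E.
Proof.
split=> [fL|[mf f2]].
  move: (fL); rewrite inE => /andP[+ _]; rewrite inE /= => mf; split => //.
  exact: integrable_lty (Lfun2_integrable_sqr fL).
rewrite inE; apply/andP; split; first by rewrite inE.
by rewrite inE /= /finite_norm Lnorm2E poweR_lty.
Qed.

Lemma integrable_mul_L2 f g : measurable_fun setT f -> measurable_fun setT g ->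
  (\int[mu]_x (f x ^+ 2)%:E < +oo)%E -> (\int[mu]_x (g x ^+ 2)%:E < +oo)%E ->
  mu.-integrable setT (fun x => (f x * g x)%:E).
Proof.
move=> mf mg f2 g2; apply/Lfun1_integrable.
by apply: Lfun2_mul_Lfun1; apply/Lfun2P.
Qed.

(** Measurability suffices: if the integral of [f] is infinite, [fine] makes the left side 0. *)
Lemma normr_Rintegral_le (f : T -> R) : measurable_fun setT f ->
  (`|\int[mu]_x f x|%:E <= \int[mu]_x `|f x|%:E)%E.
Proof.
move=> mf; have mfe : measurable_fun setT (EFin \o f) by exact/measurable_EFinP.
have H := le_abse_integral mu measurableT mfe; rewrite /Rintegral.
have I0 : (0 <= \int[mu]_x `|f x|%:E)%E by exact: integral_ge0.
move: H; rewrite /=; case: (\int[mu]_x (f x)%:E)%E => [r| |] //=; by rewrite normr0.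
Qed.

End L2_criteria.

Section line_integrals.
Context {R : realType} (a : R).
Local Notation mu := (@lebesgue_measure R).
Local Notation RR := (measurableTypeR R * measurableTypeR R)%type.
Local Notation mu2 := (mu \x mu)%E.

Definition rot (x : R * R) : R * R := x.1 *: theta a + x.2 *: theta_perp a.

(** [radon] at a single angle, for an image that is already extended by zero. *)
Definition xray (F : R * R -> R) (s : R) : R := \int[mu]_t F (rot (s, t)).

Lemma preserves_area_rot_angle : preserves_area rot.
Proof.
rewrite (_ : rot = fun x : RR =>
  (x.1 * cos a - x.2 * sin a, x.1 * sin a + x.2 * cos a)).
  by apply: preserves_area_rot; exact: cos2Dsin2.
apply/funext => x.
transitivity (x.1 * cos a + x.2 * - sin a, x.1 * sin a + x.2 * cos a) => //.
by rewrite mulrN.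
Qed.

Lemma dotp_rot (x : R * R) : dotp (rot x) (theta a) = x.1.
Proof.
rewrite /dotp /rot /GRing.scale/=.
have := cos2Dsin2 a.
set c := cos a; set d := sin a => cd.
have -> : (x.1 * c + x.2 * - d) * c + (x.1 * d + x.2 * c) * d = x.1 * (c ^+ 2 + d ^+ 2).
  by ring.
by rewrite cd mulr1.
Qed.

Lemma Omega_rot (x : R * R) : Omega (rot x) -> `|x.1| < 1 /\ `|x.2| < 1.
Proof.
rewrite /Omega /dotp /rot /GRing.scale/=.
have := cos2Dsin2 a.
set c := cos a; set d := sin a => cd.
have -> : (x.1 * c + x.2 * - d) * (x.1 * c + x.2 * - d) +
    (x.1 * d + x.2 * c) * (x.1 * d + x.2 * c) =
    (x.1 ^+ 2 + x.2 ^+ 2) * (c ^+ 2 + d ^+ 2) by ring.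
rewrite cd mulr1 -(real_normK (num_real x.1)) -(real_normK (num_real x.2)) => H.
have := sqr_ge0 `|x.1|; have := sqr_ge0 `|x.2| => ? ?.
split; rewrite -(@ltr_sqr _ _ 1) ?nnegrE// expr1n; lra.
Qed.

Lemma Omega_dotp_theta (x : R * R) : Omega x -> `|dotp x (theta a)| < 1.
Proof.
rewrite /Omega /dotp /=; have := cos2Dsin2 a.
set c := cos a; set d := sin a => cd H.
rewrite -(@ltr_sqr _ _ 1) ?nnegrE// expr1n real_normK ?num_real//.
have := sqr_ge0 (x.2 * c - x.1 * d).
have : (x.1 * c + x.2 * d) ^+ 2 + (x.2 * c - x.1 * d) ^+ 2 =
  (x.1 * x.1 + x.2 * x.2) * (c ^+ 2 + d ^+ 2) by ring.
by rewrite cd mulr1; lra.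
Qed.

Lemma measurable_rot : measurable_fun setT (rot : RR -> RR).
Proof. by case: preserves_area_rot_angle. Qed.

Lemma measurable_dotp_theta :
  measurable_fun setT (fun x : RR => dotp x (theta a)).
Proof.
by apply: measurable_funD; exact: measurable_funM.
Qed.

Lemma measurable_Omega : measurable (Omega : set RR).
Proof.
rewrite (_ : Omega = (fun x : RR => dotp x x) @^-1` `]-oo, 1[); last first.
  by apply/seteqP; split => x /=; rewrite in_itv.
rewrite -[X in measurable X]setTI.
have : measurable_fun setT (fun x : RR => dotp x x).
  by apply: measurable_funD; exact: measurable_funM.
apply=> //; exact: measurable_itv.
Qed.

Lemma ge0_integral_rot (H : RR -> \bar R) :
  measurable_fun setT H -> (forall x, 0 <= H x)%E ->
  (\int[mu2]_x H x = \int[mu]_s \int[mu]_t H (rot (s, t)))%E.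
Proof.
move=> mH H0; rewrite -(ge0_integral_preserves_area preserves_area_rot_angle mH H0).
rewrite (fubini_tonelli1 (fun x : RR => H (rot x)))//.
exact: measurableT_comp mH measurable_rot.
Qed.

Lemma measurable_indic_Omega : measurable_fun setT (\1_Omega : RR -> R).
Proof. exact: measurable_indic measurable_Omega. Qed.

(** In rotated coordinates [W] depends on s alone, and each line meets [Omega] within |t| < 1,
    whence the factor 2. This is the L^2 bound for backprojection when [W] is a square. *)
Lemma integral_strip_le (W : R -> \bar R) :
  measurable_fun setT W -> (forall s, 0 <= W s)%E ->
  (\int[mu2]_x ((\1_Omega x)%:E * W (dotp x (theta a))) <= 2%:E * \int[mu]_s W s)%E.
Proof.
move=> mW W0.
have mH : measurable_fun setT (fun x : RR => (\1_Omega x)%:E * W (dotp x (theta a)))%E.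
  apply: emeasurable_funM.
    by apply/measurable_EFinP; exact: measurable_indic_Omega.
  exact: measurableT_comp mW measurable_dotp_theta.
have H0 x : (0 <= (\1_Omega x)%:E * W (dotp x (theta a)))%E.
  by rewrite mule_ge0// lee_fin.
rewrite ge0_integral_rot// -ge0_integralZl//.
apply: ge0_le_integral => //.
- by move=> s _; exact: integral_ge0.
- apply: (measurable_fun_fubini_tonelli_F
    (fun x : RR => (\1_Omega (rot x))%:E * W (dotp (rot x) (theta a)))%E) => //.
  exact: measurableT_comp mH measurable_rot.
- exact: measurable_funeM.
move=> s _; pose E : set R := `[0 - 1, 0 + 1]%classic.
have mE : measurable E by exact: measurable_itv.
have muE : mu E = 2%:E by rewrite lebesgue_measure_itvcc_radius// mulr1.
apply: (@le_trans _ _ (\int[mu]_t ((\1_E t)%:E * W s))%E).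
  apply: ge0_le_integral => //.
  - exact: (measurableT_comp (measurableT_comp mH measurable_rot)
             (@pair1_measurable _ _ (measurableTypeR R) (measurableTypeR R) s)).
  - apply: emeasurable_funM => //.
    by apply/measurable_EFinP; exact: measurable_indic.
  move=> t _; rewrite dotp_rot lee_pmul// lee_fin !indicE.
  have [/set_mem /Omega_rot[_ /=]|] := boolP (rot (s, t) \in Omega); last by rewrite ler0n.
  rewrite ltr_norml => /andP[? ?]; rewrite mem_set// /E/= in_itv/=.
  by apply/andP; split; lra.
rewrite ge0_integralZr//; last by apply/measurable_EFinP; exact: measurable_indic.
rewrite lee_pmul//; first exact: integral_ge0.
by rewrite -muE le_eqVlt; apply/orP; left; apply/eqP; exact: integral_indicT.
Qed.

Lemma measure_Omega_lty : (mu2 Omega < +oo)%E.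
Proof.
pose E : set R := `[0 - 1, 0 + 1]%classic.
have mE : measurable E by exact: measurable_itv.
have muE : mu E = 2%:E by rewrite lebesgue_measure_itvcc_radius// mulr1.
have H : (mu2 Omega <= 2%:E * \int[mu]_s (\1_E s)%:E)%E.
  have -> : mu2 Omega = (\int[mu2]_x ((\1_Omega x)%:E * (\1_E (dotp x (theta a)))%:E))%E.
    transitivity (\int[mu2]_x (\1_(Omega : set RR) x)%:E)%E.
      by rewrite (integral_indicT _ measurable_Omega).
    apply: eq_integral => x _; rewrite !indicE.
    have [/set_mem xO|] := boolP (x \in Omega); last by rewrite mul0e.
    rewrite mem_set ?mul1e// /E/= in_itv/=.
    by move: (Omega_dotp_theta xO); rewrite ltr_norml => /andP[? ?]; apply/andP; split; lra.
  apply: (@integral_strip_le (fun s => (\1_E s)%:E)) => //.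
  by apply/measurable_EFinP; exact: measurable_indic.
apply: (le_lt_trans H).
have -> : (\int[mu]_s (\1_E s)%:E = 2%:E)%E by rewrite -muE; exact: integral_indicT.
by rewrite -EFinM ltry.
Qed.

End line_integrals.

Section xray_L2.
Context {R : realType} (a : R).
Local Notation mu := (@lebesgue_measure R).
Local Notation RR := (measurableTypeR R * measurableTypeR R)%type.
Local Notation mu2 := (mu \x mu)%E.
Variable F : RR -> R.
Hypothesis mF : measurable_fun setT F.
Hypothesis F2 : (\int[mu2]_x (F x ^+ 2)%:E < +oo)%E.
Hypothesis F0 : forall x, ~ Omega x -> F x = 0.

(** [F] is its own product with the indicator of [Omega], which is square integrable because [Omega]
    has finite area. *)
Lemma integrable_image : mu2.-integrable setT (EFin \o F).
Proof.
have O2 : (\int[mu2]_x ((\1_Omega : RR -> R) x ^+ 2)%:E < +oo)%E.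
  rewrite (_ : (fun x : RR => _) = (fun x : RR => (\1_Omega x)%:E)).
    rewrite (integral_indicT mu2 measurable_Omega); exact: measure_Omega_lty a.
  by apply/funext => x; rewrite indicE; case: (x \in _); rewrite ?expr0n ?expr1n.
have := integrable_mul_L2 mF measurable_indic_Omega F2 O2.
congr (mu2.-integrable _ _); apply/funext => x /=; rewrite indicE.
have [|/negP xO] := boolP (x \in _); first by rewrite mulr1.
by rewrite F0 ?mul0r// => xO'; apply: xO; apply: mem_set.
Qed.

Lemma measurable_line (s : R) : measurable_fun setT (fun t : R => F (rot a (s, t))).
Proof.
exact: (measurableT_comp (measurableT_comp mF (measurable_rot a))
             (@pair1_measurable _ _ (measurableTypeR R) (measurableTypeR R) s)).
Qed.

Lemma integrable_rot_image : mu2.-integrable setT (EFin \o (F \o rot a)).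
Proof. by have [] := integral_preserves_area (preserves_area_rot_angle a) integrable_image. Qed.

Lemma measurable_xray : measurable_fun setT (xray a F).
Proof. exact: measurableT_comp (measurable_fubini_F integrable_rot_image). Qed.

Lemma F_rot_eq0 (s t : R) : ~~ ((`|s| < 1) && (`|t| < 1)) -> F (rot a (s, t)) = 0.
Proof.
move=> H; apply: F0 => /Omega_rot [/= h1 h2]; by rewrite h1 h2 in H.
Qed.

Lemma xray_eq0 (s : R) : 1 <= `|s| -> xray a F s = 0.
Proof.
move=> s1; rewrite /xray.
under eq_Rintegral do rewrite F_rot_eq0 1?ltNge ?s1//.
by rewrite Rintegral_cst// mul0r.
Qed.

(** Cauchy-Schwarz on the chord, which lies in a segment of length 2. *)
Lemma xray_sqr_le (s : R) :
  ((xray a F s ^+ 2)%:E <= 2%:E * \int[mu]_t (F (rot a (s, t)) ^+ 2)%:E)%E.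
Proof.
pose E : set R := `[0 - 1, 0 + 1]%classic.
have mE : measurable E by exact: measurable_itv.
have muE : mu E = 2%:E by rewrite lebesgue_measure_itvcc_radius// mulr1.
have tE t : t \notin E -> ~~ (`|t| < 1).
  apply: contra => t1; apply: mem_set; move: t1; rewrite /E/= in_itv/= ltr_norml.
  by move=> /andP[? ?]; apply/andP; split; lra.
have Fs := measurable_line s.
have H : (`|xray a F s|%:E <= \int[mu]_(t in E) `|F (rot a (s, t))|%:E)%E.
  apply: (le_trans (normr_Rintegral_le mu Fs)).
  rewrite [leRHS]integral_mkcond le_eqVlt; apply/orP; left; apply/eqP.
  apply: eq_integral => t _; rewrite patchE; case: ifPn => // /tE t1.
  by rewrite F_rot_eq0 ?normr0// negb_and t1 orbT.
have muE2 : (mu E <= 2%:E)%E by rewrite muE.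
have := @sqr_le_integral_sqr _ _ R mu E 2 (fun t : R => F (rot a (s, t)))
  `|xray a F s| mE (ltr0Sn _ _) muE2 (measurable_funTS Fs) (normr_ge0 _) H.
rewrite real_normK ?num_real// => /le_trans; apply.
rewrite lee_pmul2l//; apply: ge0_subset_integral => //.
- by apply/measurable_EFinP; exact: measurable_funX.
- by move=> t _; rewrite lee_fin sqr_ge0.
Qed.

(** Continuity of the transform in L^2: the line-integral formula itself yields a square integrable
    function, with the square of the norm growing at most by the diameter 2. *)
Lemma integral_xray_sqr_le :
  (\int[mu]_s (xray a F s ^+ 2)%:E <= 2%:E * \int[mu2]_x (F x ^+ 2)%:E)%E.
Proof.
have mF2 : measurable_fun setT (fun x => (F x ^+ 2)%:E).
  by apply/measurable_EFinP; exact: measurable_funX.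
rewrite (ge0_integral_rot a mF2); last by move=> x; rewrite lee_fin sqr_ge0.
have mI : measurable_fun setT (fun s : R => \int[mu]_t (F (rot a (s, t)) ^+ 2)%:E)%E.
  apply: (measurable_fun_fubini_tonelli_F (fun x : RR => (F (rot a x) ^+ 2)%:E)).
    exact: measurableT_comp mF2 (measurable_rot a).
  by move=> x; rewrite lee_fin sqr_ge0.
have I0 (s : R) : (0 <= \int[mu]_t (F (rot a (s, t)) ^+ 2)%:E)%E.
  by apply: integral_ge0 => t _; rewrite lee_fin sqr_ge0.
rewrite -ge0_integralZl//.
apply: ge0_le_integral => //.
- by move=> s _; rewrite lee_fin sqr_ge0.
- by apply/measurable_EFinP; apply: measurable_funX; exact: measurable_xray.
- exact: measurable_funeM.
- by move=> s _; exact: xray_sqr_le.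
Qed.

(** In the coordinates (s, t) the second factor becomes [g s], and Fubini integrates [F] along
    lines. It is used with a sinogram for the adjoint, and with a hat to rewrite window averages of
    the transform. *)
Lemma xray_duality (g : R -> R) : measurable_fun setT g ->
  mu2.-integrable setT (fun x => (F x * g (dotp x (theta a)))%:E) ->
  (\int[mu]_s (xray a F s * g s)%:E =
   \int[mu2]_x (F x * g (dotp x (theta a)))%:E)%E.
Proof.
move=> mg iFg.
have [iH <-] := integral_preserves_area (preserves_area_rot_angle a) iFg.
rewrite -(integral12_prod_meas1 iH).
apply: ae_eq_integral => //.
- apply/measurable_EFinP; apply: measurable_funM => //; exact: measurable_xray.
- exact: measurable_fubini_F iH.
(* The factor [g s] leaves the inner integral on lines where [F] is integrable, that is, for almost
   every s. *)
have := ae_integrable1 integrable_rot_image.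
apply: filterS => s /= iFs _; rewrite /fubini_F/=.
under eq_integral do rewrite dotp_rot/= EFinM.
rewrite integralZr// EFinM; congr (_ * _)%E.
by rewrite /xray /Rintegral fineK// integrable_fin_num.
Qed.

End xray_L2.

(** * Error of the discrete transform *)

Section kernel_average.
Context {R : realType}.
Local Notation mu := (@lebesgue_measure R).
Variables (d c : R) (k g : R -> R).
Hypothesis d0 : 0 < d.
Hypotheses (mk : measurable_fun setT k) (k0 : forall u, 0 <= k u)
  (kd : forall u, k u <= d) (ksupp : forall u, 3 * d < `|u - c| -> k u = 0)
  (k1 : (\int[mu]_u (k u)%:E = (d ^+ 2)%:E)%E).
Hypotheses (mg : measurable_fun setT g)
  (g2 : (\int[mu]_u (g u ^+ 2)%:E < +oo)%E).

Lemma integrable_kernel : mu.-integrable setT (EFin \o k).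
Proof.
apply/integrableP; split; first exact/measurable_EFinP.
by under eq_integral do rewrite /= ger0_norm//; rewrite k1 ltry.
Qed.

(** Since 0 <= k <= d gives k^2 <= d k, the kernel is square integrable, as [g] is. *)
Lemma integrable_kernel_mul : mu.-integrable setT (fun u => (k u * g u)%:E).
Proof.
apply: integrable_mul_L2 => //.
apply: (@le_lt_trans _ _ (\int[mu]_u (d%:E * (k u)%:E))%E).
  apply: ge0_le_integral => //.
  - by move=> u _; rewrite lee_fin sqr_ge0.
  - by apply/measurable_EFinP; exact: measurable_funX.
  - by apply: measurable_funeM; exact/measurable_EFinP.
  - by move=> u _; rewrite -EFinM lee_fin expr2 ler_wpM2r.
rewrite ge0_integralZl ?lee_fin ?(ltW d0)//; last 2 first.
- exact/measurable_EFinP.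
- by move=> u _; rewrite lee_fin.
by rewrite k1 -EFinM ltry.
Qed.

(** As k has integral d^2, the error b is d^-2 times the integral of k(u) (g c - g u). With k <= d
    on a window of length 6 d, d |b| is at most the integral of |g c - g u| there, and
    Cauchy-Schwarz gives d^2 b^2 <= 6 d times the integral of the square. Both errors use this, with
    k a function of the offset s for the adjoint and of x.theta for the forward transform. *)
Lemma kernel_average :
  (((g c - (d ^+ 2)^-1 * \int[mu]_u (k u * g u)) ^+ 2)%:E <=
   (6 / d)%:E * \int[mu]_(u in `[(c - 3 * d)%R, (c + 3 * d)%R]) ((g c - g u) ^+ 2)%:E)%E.
Proof.
set b := g c - _.
pose E : set R := `[c - 3 * d, c + 3 * d]%classic.
have mE : measurable E by exact: measurable_itv.
have d3 : 0 <= 3 * d by rewrite mulr_ge0// ltW.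
have muE : (mu E <= (6 * d)%:E)%E.
  rewrite (lebesgue_measure_itvcc_radius c d3) lee_fin; lra.
have mgc : measurable_fun setT (fun u => g c - g u) by exact: measurable_funB.
have bE : b = (d ^+ 2)^-1 * \int[mu]_u (k u * (g c - g u)).
  under eq_Rintegral do rewrite mulrBr.
  rewrite RintegralB//; last 2 first.
  - have := integrableZr measurableT (g c) integrable_kernel.
    by congr (mu.-integrable _ _); apply/funext => u /=.
  - exact: integrable_kernel_mul.
  rewrite RintegralZr//; last exact: integrable_kernel.
  have -> : \int[mu]_u k u = d ^+ 2 by rewrite /Rintegral k1.
  by rewrite mulrBr mulrA mulVf ?mul1r// expf_neq0// gt_eqF.
have bdE : ((d * `|b|)%:E <= \int[mu]_(u in E) `|g c - g u|%:E)%E.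
  have mkg : measurable_fun setT (fun u => k u * (g c - g u)).
    exact: measurable_funM.
  have mkg' : measurable_fun setT (fun u => k u * `|g c - g u|).
    by apply: measurable_funM => //; exact: measurableT_comp.
  have H : (\int[mu]_u (k u * `|g c - g u|)%:E <=
            d%:E * \int[mu]_(u in E) `|g c - g u|%:E)%E.
    rewrite [X in (_ <= _ * X)%E]integral_mkcond.
    have mres : measurable_fun setT ((fun u => `|g c - g u|%:E) \_ E).
      apply: (measurable_restrictT _ mE).1; apply/measurable_EFinP.
      by apply: measurable_funTS; exact: measurableT_comp.
    have res0 u : (0 <= ((fun u => `|g c - g u|%:E) \_ E) u)%E.
      by rewrite patchE; case: ifP; rewrite ?lee_fin.
    rewrite -ge0_integralZl ?lee_fin ?(ltW d0)//.
    apply: ge0_le_integral => //.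
    - by move=> u _; rewrite lee_fin mulr_ge0.
    - exact/measurable_EFinP.
    - exact: measurable_funeM.
    move=> u _; rewrite patchE; case: ifPn => uE.
      by rewrite -EFinM lee_fin ler_wpM2r.
    rewrite ksupp ?mul0r ?mule0//; rewrite ltNge ler_norml; apply: contra uE.
    move=> /andP[? ?]; apply: mem_set; rewrite /E/= in_itv/=; apply/andP; split; lra.
  have I0 : (0 <= \int[mu]_(u in E) `|g c - g u|%:E)%E by exact: integral_ge0.
  have : (`|\int[mu]_u (k u * (g c - g u))|%:E <=
            d%:E * \int[mu]_(u in E) `|g c - g u|%:E)%E.
    apply: le_trans (normr_Rintegral_le mu mkg) _.
    apply: le_trans H; rewrite le_eqVlt; apply/orP; left; apply/eqP.
    by apply: eq_integral => u _; rewrite normrM ger0_norm.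
  have -> : `|\int[mu]_u (k u * (g c - g u))| = d * (d * `|b|).
    have d20 : 0 < (d ^+ 2)^-1 by rewrite invr_gt0 exprn_gt0.
    by rewrite bE normrM (gtr0_norm d20); field; rewrite gt_eqF.
  by rewrite EFinM lee_pmul2l// lte_fin.
have d6 : 0 < 6 * d by rewrite mulr_gt0.
have db0 : 0 <= d * `|b| by rewrite mulr_ge0// ltW.
have := @sqr_le_integral_sqr _ _ R mu E (6 * d) (fun u => g c - g u) (d * `|b|)
  mE d6 muE (measurable_funTS mgc) db0 bdE.
have V0 : (0 <= \int[mu]_(u in E) ((g c - g u) ^+ 2)%:E)%E.
  by apply: integral_ge0 => u _; rewrite lee_fin sqr_ge0.
rewrite -/E; case: (\int[mu]_(u in E) _)%E V0 => [V| |]// V0; last first.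
  by move=> _; rewrite gt0_muley ?leey// lte_fin divr_gt0.
rewrite -!EFinM !lee_fin exprMn real_normK ?num_real// => H.
rewrite mulrAC ler_pdivlMr//.
have d20 : 0 < d by [].
rewrite -(ler_pM2l d20); move: H; rewrite expr2; lra.
Qed.

End kernel_average.

(** Integrability is part of the conclusion so that the lemma applies to its own output in double
    sums. *)
Lemma Rintegral_sum d (T : measurableType d) (R : realType)
    (mu : {measure set T -> \bar R}) (I : Type) (r : seq I) (f : I -> T -> R) :
  (forall i, mu.-integrable setT (EFin \o f i)) ->
  \int[mu]_x \sum_(i <- r) f i x = \sum_(i <- r) \int[mu]_x f i x /\
  mu.-integrable setT (fun x => (\sum_(i <- r) f i x)%:E).
Proof.
move=> fi; have iS (r' : seq I) : mu.-integrable setT (fun x => (\sum_(i <- r') f i x)%:E).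
  rewrite (_ : (fun x => _) = (fun x => \sum_(i <- r') (f i x)%:E)%E).
    by apply: integrable_sum => // i _; exact: fi.
  by apply/funext => x; rewrite sumEFin.
split => //; elim: r => [|i r IHr].
  by rewrite big_nil; under eq_Rintegral do rewrite big_nil; rewrite Rintegral_cst// mul0r.
under eq_Rintegral do rewrite big_cons.
by rewrite big_cons RintegralD ?IHr//; exact: iS.
Qed.

(** * The discrete transform as an integral operator *)

Section discrete_kernel.
Context {R : realType} (D : @discretization R) (a : R).
Local Notation mu := (@lebesgue_measure R).
Local Notation RR := (measurableTypeR R * measurableTypeR R)%type.
Local Notation mu2 := (mu \x mu)%E.
Local Notation ds := (delta_s D).
Local Notation dx := (delta_x D).
Let ds0 : 0 < ds := delta_s_gt0 D.
Let dx0 : 0 < dx := delta_x_gt0 D.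

Definition pixel_point (x : R * R) : R * R :=
  (cell_center dx (nN D) x.1, cell_center dx (nM D) x.2).

(** The factor ds^-2 is left out, so that values lie in [0, ds] and the integral over s is ds^2, the
    normalization of [kernel_average]. *)
Definition discrete_kernel (x : R * R) (s : R) : R :=
  hat ds (dotp (pixel_point x) (theta a) - cell_center ds (nP D) s).

Lemma dotp_pixel_point (x : R * R) :
  `|dotp (pixel_point x) (theta a) - dotp x (theta a)| <= dx.
Proof.
rewrite /dotp /=.
have h1 := cell_center_dist (nN D) x.1 dx0.
have h2 := cell_center_dist (nM D) x.2 dx0.
have c1 : `|cos a| <= 1 by rewrite ler_norml cos_geN1 cos_le1.
have s1 : `|sin a| <= 1 by rewrite ler_norml sin_geN1 sin_le1.
move: h1 h2; set u := cell_center _ _ _; set v := cell_center _ _ _ => h1 h2.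
have -> : u * cos a + v * sin a - (x.1 * cos a + x.2 * sin a) =
  (u - x.1) * cos a + (v - x.2) * sin a by ring.
apply: le_trans (ler_normD _ _) _; rewrite !normrM [leRHS]splitr.
by rewrite lerD// -[leRHS]mulr1 ler_pM.
Qed.

Lemma discrete_kernel_ge0 x s : 0 <= discrete_kernel x s.
Proof. exact: hat_ge0. Qed.

Lemma discrete_kernel_le x s : discrete_kernel x s <= ds.
Proof. exact: hat_le (ltW ds0). Qed.

Lemma semidiscrete_kernel_eq0 (x : R * R) s :
  3 * ds < `|dotp x (theta a) - s| ->
  hat ds (dotp x (theta a) - cell_center ds (nP D) s) = 0.
Proof.
move=> h; apply: hat_eq0.
have := cell_center_dist (nP D) s ds0.
have := ler_normD (dotp x (theta a) - cell_center ds (nP D) s) (cell_center ds (nP D) s - s).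
rewrite addrA subrK; have := ds0; lra.
Qed.

(** The distances add up: ds for the radius of the hat, at most ds / 2 from s to its cell center, at
    most dx <= ds from rounding x. The constant 3 rounds 5 / 2 up. *)
Lemma discrete_kernel_eq0 (x : R * R) s : dx <= ds ->
  3 * ds < `|dotp x (theta a) - s| -> discrete_kernel x s = 0.
Proof.
move=> dxs h; apply: hat_eq0.
have := cell_center_dist (nP D) s ds0; have := dotp_pixel_point x.
set y := dotp (pixel_point x) _; set z := dotp x _ in h *.
set c := cell_center _ _ _ => h1 h2.
have := ler_normD (z - y) (y - c + (c - s)).
have := ler_normD (y - c) (c - s).
have -> : z - y + (y - c + (c - s)) = z - s by ring.
rewrite distrC in h1; have := ds0; lra.
Qed.

Lemma discrete_kernel_dist (x : R * R) s :
  `|hat ds (dotp x (theta a) - cell_center ds (nP D) s) - discrete_kernel x s| <= dx.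
Proof.
apply: le_trans (hat_lip _ _ _) _; rewrite distrC.
apply: le_trans (dotp_pixel_point x); rewrite le_eqVlt; apply/orP; left; apply/eqP.
by congr (`|_|); ring.
Qed.

Lemma measurable_pixel_point : measurable_fun setT (pixel_point : RR -> RR).
Proof.
apply: measurable_fun_plane.
  exact: measurableT_comp (measurable_cell_center _ dx0) measurable_plane1.
exact: measurableT_comp (measurable_cell_center _ dx0) measurable_plane2.
Qed.

Lemma measurable_discrete_kernel :
  measurable_fun setT (fun z : RR * measurableTypeR R => discrete_kernel z.1 z.2).
Proof.
apply: (measurableT_comp (measurable_hat ds)); apply: measurable_funB.
  apply: (measurableT_comp (measurable_dotp_theta a)).
  exact: measurableT_comp measurable_pixel_point measurable_fst.
exact: measurableT_comp (measurable_cell_center _ ds0) measurable_snd.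
Qed.

Lemma measurable_discrete_kernel1 (s : R) :
  measurable_fun setT (fun x : RR => discrete_kernel x s).
Proof.
apply: (measurableT_comp (measurable_hat ds)); apply: measurable_funB => //.
exact: (measurableT_comp (measurable_dotp_theta a) measurable_pixel_point).
Qed.

Lemma measurable_discrete_kernel2 (x : R * R) :
  measurable_fun setT (discrete_kernel x).
Proof.
apply: (measurableT_comp (measurable_hat ds)); apply: measurable_funB => //.
exact: measurable_cell_center.
Qed.

Lemma integral_discrete_kernel (x : R * R) :
  (\int[mu]_s (discrete_kernel x s)%:E = (ds ^+ 2)%:E)%E.
Proof. exact: integral_hat_cell_center. Qed.

Lemma measurable_pixel i j : measurable (pixel dx (nN D) (nM D) i j : set RR).
Proof. by apply: measurableX; exact: measurable_itv. Qed.

(** A pixel is a product of two one-dimensional cells, so [sum_offset_cell] applies once per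
    coordinate; the covering of [Omega] supplies both indices. *)
Lemma sum_pixel (x : R * R) (c : R) (y : R) : Omega x ->
  \sum_(1 <= i < (nN D).+1) \sum_(1 <= j < (nM D).+1)
    hat ds (dotp (pixel_center dx (nN D) (nM D) i j) (theta a) - c) *
    (\1_(pixel dx (nN D) (nM D) i j) x * y) =
  hat ds (dotp (pixel_point x) (theta a) - c) * y.
Proof.
move=> xO; have [i [j [i1 iN j1 jM [/= xi xj]]]] := @pixel_cover _ D x xO.
pose h1 v := hat ds (dotp (v, cell_center dx (nM D) x.2) (theta a) - c) * y.
rewrite -[RHS]/(h1 (cell_center dx (nN D) x.1)).
rewrite -(@sum_offset_cell _ dx (nN D) x.1 h1 dx0); last by exists i.
apply: eq_bigr => i' _.
pose h2 v := hat ds (dotp (offset dx (nN D) i', v) (theta a) - c) * y.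
rewrite -[h1 _]/(h2 (cell_center dx (nM D) x.2)).
rewrite -(@sum_offset_cell _ dx (nM D) x.2 h2 dx0); last by exists j.
rewrite big_distrr/=; apply: eq_bigr => j' _.
have -> : \1_(pixel dx (nN D) (nM D) i' j') x =
  \1_(offset_cell dx (nN D) i') x.1 * \1_(offset_cell dx (nM D) j') x.2 :> R.
  by rewrite !indicE in_setX -natrM mulnb.
rewrite /h2 /pixel_center -[dx *: _]/(offset dx (nN D) i', offset dx (nM D) j').
ring.
Qed.

Variable F : RR -> R.
Hypothesis mF : measurable_fun setT F.
Hypothesis F2 : (\int[mu2]_x (F x ^+ 2)%:E < +oo)%E.
Hypothesis F0 : forall x, ~ Omega x -> F x = 0.

Lemma integrable_bounded_mul (k : RR -> R) (M : R) : measurable_fun setT k ->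
  (forall x, `|k x| <= M) -> mu2.-integrable setT (fun x => (k x * F x)%:E).
Proof.
move=> mk kM.
have := integrableMr measurableT mk _ (integrable_image a mF F2 F0).
by apply; exists M; split; [exact: num_real|] => N MN x _; exact: le_trans (kM x) (ltW MN).
Qed.

Lemma integrable_discrete_kernel_mul (s : R) :
  mu2.-integrable setT (fun x => (discrete_kernel x s * F x)%:E).
Proof.
apply: (@integrable_bounded_mul _ ds); first exact: measurable_discrete_kernel1.
by move=> x; rewrite ger0_norm ?discrete_kernel_ge0// discrete_kernel_le.
Qed.

Lemma discrete_radon_kernel (s : R) : offsets s ->
  (ds ^+ 2)^-1 * \sum_(1 <= p < (nP D).+1) \1_(offset_cell ds (nP D) p) s *
    \sum_(1 <= i < (nN D).+1) \sum_(1 <= j < (nM D).+1)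
      hat ds (dotp (pixel_center dx (nN D) (nM D) i j) (theta a)
              - offset ds (nP D) p) *
      \int[mu2]_(x in pixel dx (nN D) (nM D) i j) F x =
  (ds ^+ 2)^-1 * \int[mu2]_x (discrete_kernel x s * F x).
Proof.
move=> sO; have sP := @offset_cover _ D s sO; congr (_ * _).
pose h c := \sum_(1 <= i < (nN D).+1) \sum_(1 <= j < (nM D).+1)
      hat ds (dotp (pixel_center dx (nN D) (nM D) i j) (theta a) - c) *
      \int[mu2]_(x in pixel dx (nN D) (nM D) i j) F x.
rewrite (@sum_offset_cell _ ds (nP D) s h ds0 sP) /h.
set c := cell_center _ _ _.
pose f i j (x : RR) := hat ds (dotp (pixel_center dx (nN D) (nM D) i j) (theta a) - c) *
    (\1_(pixel dx (nN D) (nM D) i j) x * F x).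
have ip i j : mu2.-integrable setT
    (fun x : RR => (\1_(pixel dx (nN D) (nM D) i j) x * F x)%:E).
  apply: (@integrable_bounded_mul _ 1).
    exact: measurable_indic (measurable_pixel i j).
  by move=> x; rewrite indicE; case: (x \in _); rewrite ?normr1 ?normr0.
have fi i j : mu2.-integrable setT (EFin \o f i j).
  have := integrableZl measurableT
    (hat ds (dotp (pixel_center dx (nN D) (nM D) i j) (theta a) - c)) (ip i j).
  exact.
transitivity (\int[mu2]_x \sum_(1 <= i < (nN D).+1) \sum_(1 <= j < (nM D).+1) f i j x).
  have [-> _] := Rintegral_sum (index_iota 1 (nN D).+1)
    (fun i => (Rintegral_sum (index_iota 1 (nM D).+1) (fi i)).2).
  apply: eq_bigr => i _; have [-> _] := Rintegral_sum (index_iota 1 (nM D).+1) (fi i).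
  apply: eq_bigr => j _; rewrite /f RintegralZl//; last exact: ip.
  congr (_ * _); rewrite Rintegral_mkcond; apply: eq_Rintegral => x _.
  by rewrite patchE indicE; case: ifP => _; rewrite ?mul1r ?mul0r.
apply: eq_Rintegral => x _; rewrite /f.
(* Points outside [Omega] may lie in no pixel, but there [F] vanishes and both sides are 0. *)
have [xO|xO] := pselect (Omega x); first by rewrite sum_pixel.
rewrite F0// mulr0 big1// => i _; rewrite big1// => j _.
by rewrite !mulr0.
Qed.

End discrete_kernel.

Section plane_measure.
Context {R : realType}.
Local Notation mu := (@lebesgue_measure R).
Local Notation RR := (measurableTypeR R * measurableTypeR R)%type.
Local Notation mu2 := (mu \x mu)%E.

(** Needed for Fubini on the product of the plane with the line of offsets. *)
Lemma sigma_finite_plane : sigma_finite [set: RR] mu2.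
Proof.
pose B n : set R := `[0 - n%:R, 0 + n%:R]%classic.
have mB n : measurable (B n) by exact: measurable_itv.
exists (fun n => B n `*` B n) => [|n].
  apply/seteqP; split => // -[x y] _.
  pose n := (Num.truncn (`|x| + `|y|)).+1.
  have xyn : `|x| + `|y| <= n%:R by rewrite ltW// truncnS_gt.
  exists n => //; split; rewrite /B/= in_itv/= sub0r add0r -ler_norml.
    by apply: le_trans xyn; rewrite lerDl.
  by apply: le_trans xyn; rewrite lerDr.
split; first by apply: measurableX; exact: mB.
have muB : mu (B n) = (2 * n%:R)%:E by exact: lebesgue_measure_itvcc_radius.
rewrite product_measure1E; [|exact: mB..].
by rewrite [ltLHS](_ : _ = ((2 * n%:R) * (2 * n%:R))%:E) ?ltry// EFinM -muB.
Qed.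

(* The sigma-finite structure of a product of sigma-finite measures is not
   inferred by unification, hence this explicit packing. *)
Definition plane_measure : {sigma_finite_measure set RR -> \bar R} :=
  HB.pack (mu2 : set RR -> \bar R) (Measure.on mu2)
    (Measure_isSigmaFinite.Build _ _ _ mu2 sigma_finite_plane).

End plane_measure.

(** * The forward error *)

Section forward_error.
Context {R : realType} (D : @discretization R) (a : R).
Local Notation mu := (@lebesgue_measure R).
Local Notation RR := (measurableTypeR R * measurableTypeR R)%type.
Local Notation mu2 := (mu \x mu)%E.
Local Notation ds := (delta_s D).
Local Notation dx := (delta_x D).
Let ds0 : 0 < ds := delta_s_gt0 D.
Let dx0 : 0 < dx := delta_x_gt0 D.
Hypothesis dxs : dx <= ds.
Variable F : RR -> R.
Hypothesis mF : measurable_fun setT F.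
Hypothesis F2 : (\int[mu2]_x (F x ^+ 2)%:E < +oo)%E.
Hypothesis F0 : forall x, ~ Omega x -> F x = 0.

Let win : set R := `[0 - 3 * ds, 0 + 3 * ds]%classic.

Let mwin : measurable win. Proof. exact: measurable_itv. Qed.

Let mu_win : mu win = (6 * ds)%:E.
Proof.
rewrite lebesgue_measure_itvcc_radius ?mulr_ge0 ?(ltW ds0)//.
by congr EFin; ring.
Qed.

Let winP (t : R) : (t \in win) = (`|t| <= 3 * ds).
Proof.
rewrite ler_norml; apply/idP/idP => [/set_mem|H]; last apply: mem_set; move: H || idtac;
  by rewrite /win/= in_itv/= sub0r add0r.
Qed.

(** The local L^2 mass of [F] near the line of offset s. It stands where the full norm would lose a
    factor ds in the squared error. *)
Definition strip_mass (s : R) : \bar R :=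
  (\int[mu2]_x (\1_win (dotp x (theta a) - s) * F x ^+ 2)%:E)%E.

Let measurable_strip :
  measurable_fun setT (fun z : measurableTypeR R * RR =>
     (\1_win (dotp z.2 (theta a) - z.1) * F z.2 ^+ 2)%:E).
Proof.
apply/measurable_EFinP; apply: measurable_funM; last first.
  by apply: measurable_funX; exact: measurableT_comp mF measurable_snd.
apply: (measurableT_comp (measurable_indic mwin)).
apply: measurable_funB; last exact: measurable_fst.
exact: measurableT_comp (measurable_dotp_theta a) measurable_snd.
Qed.

Lemma measurable_strip_mass : measurable_fun setT strip_mass.
Proof.
have z0 (z : measurableTypeR R * RR) :
    (0 <= (\1_win (dotp z.2 (theta a) - z.1) * F z.2 ^+ 2)%:E)%E.
  by rewrite lee_fin mulr_ge0// sqr_ge0.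
have H := @measurable_fun_fubini_tonelli_F _ _ (measurableTypeR R) RR R
  plane_measure _ measurable_strip z0.
exact: H.
Qed.

Lemma strip_mass_ge0 s : (0 <= strip_mass s)%E.
Proof. by apply: integral_ge0 => x _; rewrite lee_fin mulr_ge0// sqr_ge0. Qed.

(** By Tonelli, each x is counted for the offsets s within 3 ds of x.theta, an interval of length 6
    ds. *)
Lemma integral_strip_mass :
  (\int[mu]_s strip_mass s = (6 * ds)%:E * \int[mu2]_x (F x ^+ 2)%:E)%E.
Proof.
have z0 (z : measurableTypeR R * RR) :
    (0 <= (\1_win (dotp z.2 (theta a) - z.1) * F z.2 ^+ 2)%:E)%E.
  by rewrite lee_fin mulr_ge0// sqr_ge0.
have := @fubini_tonelli _ _ (measurableTypeR R) RR R mu plane_measure _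
  measurable_strip z0.
move=> /= H; rewrite [LHS]H => {H z0}.
have mF2 : measurable_fun setT (fun x => (F x ^+ 2)%:E).
  by apply/measurable_EFinP; exact: measurable_funX.
rewrite -ge0_integralZl//; last 2 first.
- by move=> x _; rewrite lee_fin sqr_ge0.
- by rewrite lee_fin mulr_ge0// ltW.
apply: eq_integral => x _ /=.
set v := dotp x (theta a).
pose W : set R := `[v - 3 * ds, v + 3 * ds]%classic.
have -> : (fun s : R => (\1_win (v - s) * F x ^+ 2)%:E) =
    (fun s => (F x ^+ 2 * \1_W s)%:E).
  apply/funext => s; rewrite mulrC !indicE; congr (_ * (_ : bool)%:R)%:E.
  rewrite winP ler_norml; apply/idP/idP => [/andP[? ?]|/set_mem].
    by apply: mem_set; rewrite /W/= in_itv/=; apply/andP; split; lra.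
  by rewrite /W/= in_itv/= => /andP[? ?]; apply/andP; split; lra.
transitivity ((F x ^+ 2)%:E * mu W)%E.
  by apply: ge0_integral_scale_indic; [exact: sqr_ge0 | exact: measurable_itv].
rewrite muleC; congr (_ * _)%E.
have ds3 : 0 <= 3 * ds by rewrite mulr_ge0// ltW.
rewrite [LHS](lebesgue_measure_itvcc_radius v ds3).
by congr EFin; ring.
Qed.

Let hats s (x : R * R) := hat ds (dotp x (theta a) - cell_center ds (nP D) s).

Let mhats s : measurable_fun setT (hats s : RR -> R).
Proof.
apply: (measurableT_comp (measurable_hat ds)); apply: measurable_funB => //.
exact: measurable_dotp_theta.
Qed.

Let ihats s : mu2.-integrable setT (fun x => (hats s x * F x)%:E).
Proof.
apply: (integrable_bounded_mul a mF F2 F0 (M := ds)) => // x.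
by rewrite ger0_norm ?hat_ge0// hat_le// ltW.
Qed.

(** The two kernels differ by at most dx and vanish off the strip. Inside [Omega] the strip has area
    at most 12 ds, its width 6 ds times the chord bound 2, and Cauchy-Schwarz on it leaves the local
    mass of [F]. *)
Lemma pixel_error (s : R) :
  (((\int[mu2]_x (hats s x * F x) - \int[mu2]_x (discrete_kernel D a x s * F x)) ^+ 2)%:E
   <= (12 * ds * dx ^+ 2)%:E * strip_mass s)%E.
Proof.
set B := _ - _.
pose E : set RR := Omega `&` [set x | dotp x (theta a) - s \in win].
have mE : measurable E.
  apply: measurableI; first exact: measurable_Omega.
  have : measurable_fun setT (fun x : RR => dotp x (theta a) - s).
    by apply: measurable_funB => //; exact: measurable_dotp_theta.
  move=> /(_ measurableT win mwin); rewrite setTI.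
  by congr measurable; apply/seteqP; split => x /= /[!inE].
have muE : (mu2 E <= (12 * ds)%:E)%E.
  have mW : measurable_fun setT (fun v : R => (\1_win (v - s))%:E : \bar R).
    apply/measurable_EFinP; apply: (measurableT_comp (measurable_indic mwin)).
    exact: measurable_funB.
  have W0 v : (0 <= (\1_win (v - s))%:E :> \bar R)%E by rewrite lee_fin.
  have := integral_strip_le a mW W0.
  rewrite (ge0_integralD_shift (- s) (f := fun v => (\1_win v)%:E)); last 2 first.
  - by apply/measurable_EFinP; exact: measurable_indic.
  - by move=> v; rewrite lee_fin.
  rewrite (_ : (\int[mu]_x (\1_win x)%:E)%E = (6 * ds)%:E); last first.
    by rewrite -mu_win; exact: integral_indicT.
  rewrite -EFinM (_ : 2 * (6 * ds) = 12 * ds); last by ring.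
  apply: le_trans; rewrite le_eqVlt; apply/orP; left; apply/eqP.
  rewrite -(integral_indicT mu2 mE); apply: eq_integral => x _.
  rewrite -EFinM; congr EFin; rewrite !indicE -natrM mulnb; congr (_ : bool)%:R.
  by rewrite in_setI; congr andb; apply/idP/idP => [/set_mem|?]; last apply: mem_set.
have mk := measurable_discrete_kernel1 D a s.
have mdiff : measurable_fun setT (fun x : RR => (hats s x - discrete_kernel D a x s) * F x).
  by apply: measurable_funM => //; exact: measurable_funB.
have BE : B = \int[mu2]_x ((hats s x - discrete_kernel D a x s) * F x).
  under eq_Rintegral do rewrite mulrBl.
  have := @RintegralB _ _ _ mu2 setT _ _ measurableT (ihats s)
    (integrable_discrete_kernel_mul D a mF F2 F0 s).
  by move->.
have H : ((`|B| / dx)%:E <= \int[mu2]_(x in E) `|F x|%:E)%E.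
  have mres : measurable_fun setT ((fun x => `|F x|%:E) \_ E).
    apply: (measurable_restrictT _ mE).1; apply/measurable_EFinP.
    by apply: measurable_funTS; exact: measurableT_comp.
  have res0 x : (0 <= ((fun x => `|F x|%:E) \_ E) x)%E.
    by rewrite patchE; case: ifP; rewrite ?lee_fin.
  have H1 : (`|B|%:E <= dx%:E * \int[mu2]_(x in E) `|F x|%:E)%E.
    rewrite BE; apply: le_trans (normr_Rintegral_le mu2 mdiff) _.
    rewrite [X in (_ <= _ * X)%E]integral_mkcond -ge0_integralZl ?lee_fin ?(ltW dx0)//.
    apply: ge0_le_integral => //.
    - by apply/measurable_EFinP; exact: measurableT_comp.
    - exact: measurable_funeM.
    move=> x _; rewrite patchE; case: ifPn => xE.
      by rewrite -EFinM lee_fin normrM ler_wpM2r// discrete_kernel_dist.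
    rewrite mule0 lee_fin.
    have [xO|xO] := pselect (Omega x); last by rewrite F0// mulr0 normr0.
    have far : 3 * ds < `|dotp x (theta a) - s|.
      by rewrite ltNge -winP; apply: contra xE => xw; apply: mem_set.
    by rewrite discrete_kernel_eq0// /hats semidiscrete_kernel_eq0// subrr mul0r normr0.
  by rewrite mulrC EFinM lee_pdivrMl.
have ds12 : 0 < 12 * ds by rewrite mulr_gt0.
have B0 : 0 <= `|B| / dx by rewrite divr_ge0// ltW.
have := @sqr_le_integral_sqr _ _ R mu2 E (12 * ds) F (`|B| / dx) mE ds12 muE
  (measurable_funTS mF) B0 H.
have sub : (\int[mu2]_(x in E) (F x ^+ 2)%:E <= strip_mass s)%E.
  rewrite integral_mkcond; apply: ge0_le_integral => //.
  - by move=> x _; rewrite patchE; case: ifP => _; rewrite ?lee_fin ?sqr_ge0.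
  - apply: (measurable_restrictT _ mE).1; apply/measurable_EFinP.
    by apply: measurable_funTS; exact: measurable_funX.
  - apply/measurable_EFinP; apply: measurable_funM; last exact: measurable_funX.
    apply: (measurableT_comp (measurable_indic mwin)); apply: measurable_funB => //.
    exact: measurable_dotp_theta.
  move=> x _; rewrite patchE; case: ifPn => [/set_mem[_ /= xw]|_].
    by rewrite lee_fin indicE xw mul1r.
  by rewrite lee_fin mulr_ge0// sqr_ge0.
move=> H2; have := le_trans H2 (lee_wpmul2l _ sub).
rewrite lee_fin (ltW ds12) => /(_ isT) H3.
rewrite (_ : 12 * ds * dx ^+ 2 = dx ^+ 2 * (12 * ds)); last by rewrite mulrC.
rewrite [X in (_ <= X * _)%E]EFinM -muleA; apply: le_trans (lee_wpmul2l _ H3); last first.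
  by rewrite lee_fin sqr_ge0.
rewrite -EFinM lee_fin exprMn real_normK ?num_real// mulrCA -exprMn.
by rewrite divff ?gt_eqF// expr1n mulr1.
Qed.

(** [r] stands for the discrete transform at one angle, whose kernel form is available on ]-1,
    1[. *)
Lemma integral_forward_error_le (r : R -> R) (M N : R) :
  measurable_fun setT r ->
  (forall s, offsets s ->
     r s = (ds ^+ 2)^-1 * \int[mu2]_x (discrete_kernel D a x s * F x)) ->
  (forall h, `|h| <= 3 * ds ->
     (\int[mu]_s ((xray a F (s + h) - xray a F s) ^+ 2)%:E <= M%:E)%E) ->
  (\int[mu2]_x (F x ^+ 2)%:E <= N%:E)%E ->
  (\int[mu]_(s in offsets) ((xray a F s - r s) ^+ 2)%:E <=
     (72 * M + 144 * (dx / ds) ^+ 2 * N)%:E)%E.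
Proof.
move=> mr rE GM FN; set G := xray a F.
have mG : measurable_fun setT G by exact: measurable_xray.
have G2 : (\int[mu]_s (G s ^+ 2)%:E < +oo)%E.
  apply: le_lt_trans (integral_xray_sqr_le a mF F2 F0) _.
  by rewrite lte_mul_pinfty ?lee_fin.
have ds3 : 0 <= 3 * ds by rewrite mulr_ge0// ltW.
pose W s : \bar R :=
  (\int[mu]_(u in `[(s - 3 * ds)%R, (s + 3 * ds)%R]) ((G s - G u) ^+ 2)%:E)%E.
have mW : measurable_fun setT W by exact: measurable_integral_sqrB.
have W0 s : (0 <= W s)%E by apply: integral_ge0 => u _; rewrite lee_fin sqr_ge0.
have mS := measurable_strip_mass.
(* From (x + y)^2 <= 2 x^2 + 2 y^2: [c1] is twice the constant 6 / ds of [kernel_average], and [c2]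
   is 2 ds^-4 times the constant 12 ds dx^2 of [pixel_error]. Windows and strips of width 6 ds then
   yield 72 and 144. *)
pose c1 := 12 / ds; pose c2 := 24 * dx ^+ 2 / ds ^+ 3.
have c10 : 0 <= c1 by rewrite divr_ge0// ltW.
have c20 : 0 <= c2.
  by apply: divr_ge0; [rewrite mulr_ge0// sqr_ge0 | rewrite exprn_ge0// ltW].
have ptw s : offsets s -> (((G s - r s) ^+ 2)%:E <=
    c1%:E * W s + c2%:E * strip_mass s)%E.
  move=> so; rewrite rE//.
  set k := fun u => hat ds (u - cell_center ds (nP D) s).
  have mk : measurable_fun setT k.
    by apply: (measurableT_comp (measurable_hat ds)); exact: measurable_funB.
  have ksupp u : 3 * ds < `|u - s| -> k u = 0.
    move=> us; apply: hat_eq0; have := cell_center_dist (nP D) s ds0.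
    have := ler_normD (u - cell_center ds (nP D) s) (cell_center ds (nP D) s - s).
    rewrite addrA subrK; have := ds0; lra.
  have kd u : k u <= ds by rewrite hat_le// ltW.
  have k0 u : 0 <= k u by exact: hat_ge0.
  have k1 : (\int[mu]_u (k u)%:E = (ds ^+ 2)%:E)%E by exact: integral_hat.
  have := kernel_average ds0 mk k0 kd ksupp k1 mG G2.
  (* Duality against the hat: this is possible because the kernel now depends on x through x.theta
     only. *)
  have -> : \int[mu]_u (k u * G u) = \int[mu2]_x (hats s x * F x).
    rewrite /Rintegral; congr fine.
    under eq_integral do rewrite mulrC.
    under [RHS]eq_integral do rewrite mulrC.
    apply: (xray_duality mF F2 F0 mk).
    by under eq_fun do rewrite mulrC; exact: ihats.
  have := pixel_error s.
  set A := Rintegral _ _ _; set B := Rintegral _ _ _; rewrite -/(W s).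
  set e := (ds ^+ 2)^-1.
  have e0 : 0 < e by rewrite invr_gt0 exprn_gt0.
  move=> HB HA.
  apply: (@le_trans _ _ (2%:E * ((G s - e * A) ^+ 2)%:E +
       (2 * e ^+ 2)%:E * ((A - B) ^+ 2)%:E)%E).
    rewrite -!EFinM -EFinD lee_fin.
    have -> : G s - e * B = (G s - e * A) + e * (A - B) by ring.
    move: (G s - e * A) (A - B) => x y.
    rewrite -subr_ge0 [leRHS](_ : _ = (x - e * y) ^+ 2) ?sqr_ge0//; by ring.
  apply: leeD.
    apply: le_trans (lee_wpmul2l _ HA) _; first by rewrite lee_fin.
    rewrite muleA -EFinM (_ : 2 * (6 / ds) = c1)// /c1; field; exact: lt0r_neq0.
  apply: le_trans (lee_wpmul2l _ HB) _.
    by rewrite lee_fin mulr_ge0// sqr_ge0.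
  rewrite muleA -EFinM (_ : 2 * e ^+ 2 * (12 * ds * dx ^+ 2) = c2)// /c2 /e.
  by field; exact: lt0r_neq0.
have moff : measurable (offsets : set R) by exact: measurable_itv.
have mGr : measurable_fun setT (fun s => ((G s - r s) ^+ 2)%:E).
  by apply/measurable_EFinP; apply: measurable_funX; exact: measurable_funB.
apply: (@le_trans _ _ (\int[mu]_s (c1%:E * W s + c2%:E * strip_mass s))%E).
  rewrite integral_mkcond; apply: ge0_le_integral => //.
  - by move=> s _; rewrite patchE; case: ifP; rewrite ?lee_fin ?sqr_ge0.
  - by apply: (measurable_restrictT _ moff).1; exact: measurable_funTS.
  - by apply: emeasurable_funD; exact: measurable_funeM.
  - move=> s _; rewrite patchE; case: ifPn => [/set_mem|_]; first exact: ptw.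
    by rewrite adde_ge0// mule_ge0 ?lee_fin ?strip_mass_ge0.
rewrite ge0_integralD//; first last.
- exact: measurable_funeM.
- by move=> s _; rewrite mule_ge0 ?lee_fin ?strip_mass_ge0.
- exact: measurable_funeM.
- by move=> s _; rewrite mule_ge0 ?lee_fin.
rewrite !ge0_integralZl ?lee_fin//; last by move=> s _; exact: strip_mass_ge0.
rewrite integral_strip_mass.
have HW := integral_sqrB_le ds3 mG GM.
apply: (@le_trans _ _ (c1%:E * (2 * (3 * ds) * M)%:E + c2%:E * ((6 * ds)%:E * N%:E))%E).
  apply: leeD; apply: lee_wpmul2l; rewrite ?lee_fin//.
  by apply: lee_wpmul2l; rewrite ?lee_fin// mulr_ge0// ltW.
rewrite -!EFinM -EFinD lee_fin le_eqVlt; apply/orP; left; apply/eqP.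
by rewrite /c1 /c2; field; exact: lt0r_neq0.
Qed.

End forward_error.

(** * Adjoints *)

Section backprojection.
Context {R : realType} (a : R).
Local Notation mu := (@lebesgue_measure R).
Local Notation RR := (measurableTypeR R * measurableTypeR R)%type.
Local Notation mu2 := (mu \x mu)%E.
Variable g : R -> R.
Hypothesis mg : measurable_fun setT g.
Hypothesis g2 : (\int[mu]_s (g s ^+ 2)%:E < +oo)%E.
Hypothesis g0 : forall s, ~ offsets s -> g s = 0.

Definition backprojection (x : R * R) : R := g (dotp x (theta a)).

Lemma measurable_backprojection : measurable_fun setT (backprojection : RR -> R).
Proof. exact: measurableT_comp mg (measurable_dotp_theta a). Qed.

Lemma backprojection_L2 :
  (\int[mu2]_x (((backprojection \_ Omega) x) ^+ 2)%:E < +oo)%E.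
Proof.
have mg2 : measurable_fun setT (fun s => (g s ^+ 2)%:E).
  by apply/measurable_EFinP; exact: measurable_funX.
have g20 s : (0 <= (g s ^+ 2)%:E)%E by rewrite lee_fin sqr_ge0.
apply: le_lt_trans (_ : (2%:E * \int[mu]_s (g s ^+ 2)%:E < +oo)%E); last first.
  by rewrite lte_mul_pinfty ?lee_fin.
apply: le_trans (integral_strip_le a mg2 g20).
rewrite le_eqVlt; apply/orP; left; apply/eqP; apply: eq_integral => x _.
rewrite patchE indicE /backprojection; case: ifP => _; first by rewrite mul1e.
by rewrite expr0n mul0e.
Qed.

Section duality.
Variable F : RR -> R.
Hypothesis mF : measurable_fun setT F.
Hypothesis F2 : (\int[mu2]_x (F x ^+ 2)%:E < +oo)%E.
Hypothesis F0 : forall x, ~ Omega x -> F x = 0.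

(** A backprojection is constant along lines, so in general it is square integrable only after
    restriction to [Omega]; against [F] the restriction changes nothing. *)
Lemma patch_Omega_mul (h : R * R -> R) x : F x * (h \_ Omega) x = F x * h x.
Proof.
rewrite patchE; case: ifPn => // /negP xO; rewrite F0 ?mul0r// => xO'.
by apply: xO; apply: mem_set.
Qed.

Lemma integrable_mul_backprojection :
  mu2.-integrable setT (fun x => (F x * backprojection x)%:E).
Proof.
have mb : measurable_fun setT (backprojection \_ Omega : RR -> R).
  apply: (measurable_restrictT _ measurable_Omega).1.
  exact: measurable_funTS measurable_backprojection.
have := integrable_mul_L2 mF mb F2 backprojection_L2.
by congr (mu2.-integrable _ _); apply/funext => x; rewrite patch_Omega_mul.
Qed.

Lemma radon_duality :
  (\int[mu]_s (xray a F s * g s)%:E = \int[mu2]_x (F x * backprojection x)%:E)%E.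
Proof.
apply: (xray_duality mF F2 F0 mg); exact: integrable_mul_backprojection.
Qed.

End duality.

Lemma integrable_sinogram : mu.-integrable setT (EFin \o g).
Proof.
have moff : measurable (offsets : set R) by exact: measurable_itv.
have O2 : (\int[mu]_s ((\1_offsets s : R) ^+ 2)%:E < +oo)%E.
  rewrite (_ : (\int[mu]_s _)%E = mu offsets); last first.
    rewrite -(integral_indicT mu moff); apply: eq_integral => s _.
    by rewrite indicE; case: (s \in _); rewrite ?expr0n ?expr1n.
  by rewrite /offsets lebesgue_measure_itv/= lte_fin; case: ifP => _; rewrite ?ltry.
have := @integrable_mul_L2 _ (measurableTypeR R) R mu _ _ mg (measurable_indic moff) g2 O2.
congr (mu.-integrable _ _); apply/funext => s /=; rewrite indicE.
have [|/negP so] := boolP (s \in _); first by rewrite mulr1.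
by rewrite g0 ?mul0r// => so'; apply: so; apply: mem_set.
Qed.

Variable D : @discretization R.
Local Notation ds := (delta_s D).
Local Notation dx := (delta_x D).
Let ds0 : 0 < ds := delta_s_gt0 D.
Let dx0 : 0 < dx := delta_x_gt0 D.

Definition discrete_backprojection (x : R * R) : R :=
  (ds ^+ 2)^-1 * \int[mu]_s (discrete_kernel D a x s * g s).

Lemma integrable_discrete_kernel_sinogram (x : R * R) :
  mu.-integrable setT (fun s => (discrete_kernel D a x s * g s)%:E).
Proof.
apply: (integrable_kernel_mul (d := ds) ds0) => //.
- exact: measurable_discrete_kernel2.
- exact: discrete_kernel_ge0.
- exact: discrete_kernel_le.
- exact: integral_discrete_kernel.
Qed.

Let I := \int[mu]_s `|g s|.

Let I_fin : (\int[mu]_s `|g s|%:E = I%:E)%E.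
Proof.
rewrite /I /Rintegral fineK//; apply: integrable_fin_num => //.
exact: integrable_norm integrable_sinogram.
Qed.

(** The kernel is at most ds. The bound degenerates as ds tends to 0 and only serves membership in
    L^2 for a fixed discretization. *)
Lemma discrete_backprojection_bounded x :
  `|discrete_backprojection x| <= ds^-1 * I.
Proof.
rewrite /discrete_backprojection normrM gtr0_norm ?invr_gt0 ?exprn_gt0//.
rewrite -(@ler_pM2l _ (ds ^+ 2)) ?exprn_gt0// mulrA mulfV ?mul1r; last first.
  by rewrite expf_neq0// gt_eqF.
rewrite mulrA expr2 mulfK ?gt_eqF//.
have mkg : measurable_fun setT (fun s => discrete_kernel D a x s * g s).
  by apply: measurable_funM => //; exact: measurable_discrete_kernel2.
rewrite -lee_fin; apply: le_trans (normr_Rintegral_le mu mkg) _.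
rewrite EFinM -I_fin.
have mag : measurable_fun setT (fun s => `|g s|%:E).
  by apply/measurable_EFinP; exact: measurableT_comp.
rewrite -ge0_integralZl ?lee_fin ?(ltW ds0)//.
apply: ge0_le_integral => //.
- by apply/measurable_EFinP; exact: measurableT_comp.
- exact: measurable_funeM.
- move=> s _; rewrite -EFinM lee_fin normrM ler_wpM2r//.
  by rewrite ger0_norm ?discrete_kernel_ge0// discrete_kernel_le.
Qed.

(** The integrand of the discrete pairing on plane times line, up to ds^-2. Its integrability
    justifies Fubini. *)
Let triple (F : RR -> R) (z : RR * measurableTypeR R) : R :=
  F z.1 * (discrete_kernel D a z.1 z.2 * g z.2).

Let measurable_triple (F : RR -> R) : measurable_fun setT F ->
  measurable_fun setT (triple F).
Proof.
move=> mF; apply: measurable_funM; first exact: measurableT_comp mF measurable_fst.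
apply: measurable_funM; first exact: measurable_discrete_kernel.
exact: (measurableT_comp mg (@measurable_snd _ _ RR (measurableTypeR R))).
Qed.

Let integrable_triple (F : RR -> R) : measurable_fun setT F ->
  mu2.-integrable setT (EFin \o F) ->
  (plane_measure \x mu)%E.-integrable setT (EFin \o triple F).
Proof.
move=> mF iF.
have mT : measurable_fun setT (EFin \o triple F).
  by apply/measurable_EFinP; exact: measurable_triple.
apply/(integrable12ltyP plane_measure mu mT).
have mFe : measurable_fun setT (fun x : RR => `|F x|%:E).
  by apply/measurable_EFinP; exact: measurableT_comp.
apply: (@le_lt_trans _ _ (\int[mu2]_x ((ds * I)%:E * `|F x|%:E))%E).
  apply: ge0_le_integral => //.
  - by move=> x _; exact: integral_ge0.
  - apply: (@measurable_fun_fubini_tonelli_F _ _ RR (measurableTypeR R) R mu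
      (fun z => `|(triple F z)%:E|)%E) => //.
    exact: measurableT_comp.
  - exact: measurable_funeM.
  move=> x _.
  apply: (@le_trans _ _ (\int[mu]_s ((`|F x| * ds)%:E * `|g s|%:E))%E).
    apply: ge0_le_integral => //.
    - apply: measurableT_comp => //; apply/measurable_EFinP.
      have mkg : measurable_fun setT (fun s => discrete_kernel D a x s * g s).
        by apply: measurable_funM => //; exact: measurable_discrete_kernel2.
      exact: (measurable_funM (measurable_cst (F x)) mkg).
    - apply: measurable_funeM; apply/measurable_EFinP; exact: measurableT_comp.
    - move=> s _; rewrite /triple/= -EFinM lee_fin !normrM mulrA.
      rewrite ler_wpM2r// ler_wpM2l// ger0_norm ?discrete_kernel_ge0//.
      exact: discrete_kernel_le.
  rewrite ge0_integralZl//; last 2 first.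
  - by apply/measurable_EFinP; exact: measurableT_comp.
  - by rewrite lee_fin mulr_ge0// ltW.
  by rewrite I_fin -!EFinM lee_fin le_eqVlt; apply/orP; left; apply/eqP; ring.
have I0 : 0 <= I by exact: Rintegral_ge0.
rewrite ge0_integralZl// ?lee_fin ?mulr_ge0 ?(ltW ds0)//.
rewrite lte_mul_pinfty ?lee_fin ?mulr_ge0 ?(ltW ds0)//.
by case/integrableP : iF.
Qed.

Lemma discrete_radon_duality (F : RR -> R) : measurable_fun setT F ->
  (\int[mu2]_x (F x ^+ 2)%:E < +oo)%E -> (forall x, ~ Omega x -> F x = 0) ->
  (\int[mu]_s (((ds ^+ 2)^-1 * \int[mu2]_x (discrete_kernel D a x s * F x)) * g s)%:E =
   \int[mu2]_x (F x * discrete_backprojection x)%:E)%E.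
Proof.
move=> mF F2 F0; have iT := integrable_triple mF (integrable_image a mF F2 F0).
set e := (ds ^+ 2)^-1.
have := @Fubini _ _ RR (measurableTypeR R) R plane_measure mu _
  (integrableZl measurableT e iT).
rewrite [LHS](_ : _ = \int[mu2]_x (F x * discrete_backprojection x)%:E)%E; last first.
  apply: eq_integral => x _; rewrite /fubini_F/= /triple/=.
  have iks := integrable_discrete_kernel_sinogram x.
  rewrite (_ : (fun s => _) =
      (fun s : measurableTypeR R => (F x * e)%:E * (discrete_kernel D a x s * g s)%:E)%E).
    rewrite (integralZl measurableT iks).
    rewrite /discrete_backprojection mulrA [RHS]EFinM /Rintegral fineK//.
    exact: (integrable_fin_num measurableT iks).
  by apply/funext => s; rewrite -!EFinM; congr EFin; ring.
move=> ->; apply: eq_integral => s _; rewrite /fubini_G/= /triple/=.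
have ik := integrable_discrete_kernel_mul D a mF F2 F0 s.
rewrite (_ : (fun x => _) =
    (fun x : RR => (e * g s)%:E * (discrete_kernel D a x s * F x)%:E)%E).
  rewrite [RHS](integralZl measurableT ik) mulrAC [LHS]EFinM /Rintegral fineK//.
  exact: (integrable_fin_num measurableT ik).
by apply/funext => x; rewrite -!EFinM; congr EFin; ring.
Qed.

(** Up to ds^-2 the function is an inner integral of [triple \1_Omega], hence measurable by
    Fubini. *)
Lemma measurable_discrete_backprojection :
  measurable_fun setT (discrete_backprojection \_ Omega : RR -> R).
Proof.
have iO : mu2.-integrable setT (EFin \o (\1_Omega : RR -> R)).
  apply/integrableP; split.
    by apply/measurable_EFinP; exact: measurable_indic_Omega.
  under eq_integral do rewrite /= ger0_norm//.
  by rewrite (integral_indicT mu2 measurable_Omega); exact: measure_Omega_lty a.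
have mf := measurableT_comp (@fine_measurable R setT measurableT)
  (@measurable_fubini_F _ _ RR (measurableTypeR R) R plane_measure mu _
    (integrable_triple measurable_indic_Omega iO)).
have mm : measurable_fun setT (fun x : RR => (ds ^+ 2)^-1 *
    fine (\int[mu]_s (triple \1_Omega (x, s))%:E)).
  by apply: measurable_funM => //; exact: mf.
rewrite (_ : _ \_ _ = (fun x : RR => (ds ^+ 2)^-1 *
    fine (\int[mu]_s (triple \1_Omega (x, s))%:E)%E)); first exact: mm.
apply/funext => x; rewrite patchE /triple/= indicE.
case: (x \in Omega); rewrite /discrete_backprojection /Rintegral.
  by under [in RHS]eq_integral do rewrite mul1r.
under [in RHS]eq_integral do rewrite mul0r.
by rewrite integral0 mulr0.
Qed.

Lemma discrete_backprojection_L2 :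
  (\int[mu2]_x (((discrete_backprojection \_ Omega) x) ^+ 2)%:E < +oo)%E.
Proof.
have mO : measurable_fun setT (fun x : RR => (\1_Omega x)%:E : \bar R).
  by apply/measurable_EFinP; exact: measurable_indic_Omega.
apply: (@le_lt_trans _ _ (\int[mu2]_x (((ds^-1 * I) ^+ 2)%:E * (\1_Omega x)%:E))%E).
  apply: ge0_le_integral => //.
  - by move=> x _; rewrite lee_fin sqr_ge0.
  - apply/measurable_EFinP; apply: measurable_funX.
    exact: measurable_discrete_backprojection.
  - exact: measurable_funeM.
  move=> x _; rewrite -EFinM lee_fin patchE indicE.
  case: ifP => _; last by rewrite expr0n mulr0.
  rewrite mulr1 -(real_normK (num_real (discrete_backprojection x))).
  have H := discrete_backprojection_bounded x.
  by rewrite ler_sqr ?nnegrE// (le_trans _ H).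
rewrite ge0_integralZl ?lee_fin ?sqr_ge0//.
rewrite (integral_indicT mu2 measurable_Omega).
by rewrite lte_mul_pinfty ?lee_fin ?sqr_ge0//; exact: measure_Omega_lty a.
Qed.

(** [kernel_average] centered at x.theta gives a pointwise bound that depends on x.theta alone, so
    [integral_strip_le] applies. The constant is 2 (strip) times 6 / ds (average) times 6 ds
    (window). *)
Lemma integral_backprojection_error_le (M : R) : dx <= ds ->
  (forall h, `|h| <= 3 * ds ->
     (\int[mu]_s ((g (s + h) - g s) ^+ 2)%:E <= M%:E)%E) ->
  (\int[mu2]_x (((backprojection \_ Omega) x - (discrete_backprojection \_ Omega) x) ^+ 2)%:E
    <= (72 * M)%:E)%E.
Proof.
move=> dxs gM.
have ds3 : 0 <= 3 * ds by rewrite mulr_ge0// ltW.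
pose W s : \bar R :=
  (\int[mu]_(u in `[(s - 3 * ds)%R, (s + 3 * ds)%R]) ((g s - g u) ^+ 2)%:E)%E.
have mW : measurable_fun setT W by exact: measurable_integral_sqrB.
have W0 s : (0 <= W s)%E by apply: integral_ge0 => u _; rewrite lee_fin sqr_ge0.
have c0 : (0 <= (6 / ds)%:E :> \bar R)%E by rewrite lee_fin divr_ge0// ltW.
have mb : measurable_fun setT (backprojection \_ Omega : RR -> R).
  apply: (measurable_restrictT _ measurable_Omega).1.
  exact: measurable_funTS measurable_backprojection.
have mcW : measurable_fun setT (fun s => (6 / ds)%:E * W s)%E.
  exact: measurable_funeM.
have cW0 s : (0 <= (6 / ds)%:E * W s)%E by rewrite mule_ge0.
apply: (@le_trans _ _ (\int[mu2]_x ((\1_Omega x)%:E *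
     ((6 / ds)%:E * W (dotp x (theta a))))))%E.
  apply: ge0_le_integral => //.
  - by move=> x _; rewrite lee_fin sqr_ge0.
  - apply/measurable_EFinP; apply: measurable_funX; apply: measurable_funB => //.
    exact: measurable_discrete_backprojection.
  - apply: emeasurable_funM.
      by apply/measurable_EFinP; exact: measurable_indic_Omega.
    exact: measurableT_comp mcW (measurable_dotp_theta a).
  move=> x _; rewrite !patchE indicE; case: ifPn => xO; last first.
    by rewrite subrr expr0n mul0e.
  rewrite mul1e.
  have ksupp u : 3 * ds < `|u - dotp x (theta a)| -> discrete_kernel D a x u = 0.
    by rewrite distrC; exact: discrete_kernel_eq0.
  exact: (kernel_average ds0 (measurable_discrete_kernel2 D a x)
    (discrete_kernel_ge0 D a x) (discrete_kernel_le D a x) ksupp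
    (integral_discrete_kernel D a x) mg g2).
apply: le_trans (integral_strip_le a mcW cW0) _.
rewrite ge0_integralZl//.
have HW := integral_sqrB_le ds3 mg gM.
apply: (@le_trans _ _ (2%:E * ((6 / ds)%:E * (2 * (3 * ds) * M)%:E))%E).
  by do 2 (apply: lee_wpmul2l; first by rewrite ?lee_fin).
rewrite -!EFinM lee_fin le_eqVlt; apply/orP; left; apply/eqP.
by field; exact: lt0r_neq0.
Qed.

End backprojection.

(** * Inner products, norms and representatives of adjoints *)

Section L2_spaces_facts.
Context {R : realType}.
Local Notation mu := (@lebesgue_measure R).
Local Notation RR := (measurableTypeR R * measurableTypeR R)%type.
Local Notation mu2 := (mu \x mu)%E.
Implicit Types f h : R * R -> R.

Lemma L2_imageP f : L2_image f <-> measurable_fun setT (f \_ Omega : RR -> R) /\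
  (\int[mu2]_x (((f \_ Omega) x) ^+ 2)%:E < +oo)%E.
Proof. exact: (Lfun2P mu2 (f \_ Omega)). Qed.

Lemma patch_Omega_eq0 f x : ~ Omega x -> (f \_ Omega) x = 0.
Proof. by move=> xO; rewrite patchE memNset. Qed.

Lemma ip_imageE f h : ip_image f h = \int[mu2]_x ((f \_ Omega) x * (h \_ Omega) x).
Proof.
rewrite /ip_image Rintegral_mkcond; apply: eq_Rintegral => x _.
by rewrite !patchE; case: ifP => _; rewrite ?mulr0.
Qed.

Lemma integrable_ip f h : L2_image f -> L2_image h ->
  mu2.-integrable setT (fun x => ((f \_ Omega) x * (h \_ Omega) x)%:E).
Proof. by move=> /L2_imageP[mf f2] /L2_imageP[mh h2]; exact: integrable_mul_L2. Qed.

Lemma L2_image_sum (I : Type) (r : seq I) (h : I -> R * R -> R) :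
  (forall i, L2_image (h i)) -> L2_image (fun x => \sum_(i <- r) h i x).
Proof.
move=> hi; elim: r => [|i r IHr].
  rewrite (_ : (fun _ => _) = cst 0); last by apply/funext => x; rewrite big_nil.
  rewrite /L2_image/= (_ : _ \_ _ = 0); last first.
    by apply/funext => x; rewrite patchE; case: ifP.
  by have [] := @Lfun_addr_closed _ _ R mu2 _ (lee1n 2).
rewrite (_ : (fun _ => _) = h i \+ (fun x => \sum_(i <- r) h i x)); last first.
  by apply/funext => x; rewrite big_cons.
rewrite /L2_image/= (_ : _ \_ _ = (h i \_ Omega) + ((fun x => \sum_(i <- r) h i x) \_ Omega)).
  have [_ addL] := @Lfun_addr_closed _ _ R mu2 _ (lee1n 2).
  by apply: addL; [exact: hi | exact: IHr].
by apply/funext => x; rewrite [in RHS]/GRing.add/= !patchE; case: ifP; rewrite ?addr0.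
Qed.

Lemma L2_imageB f h : L2_image f -> L2_image h -> L2_image (f \- h).
Proof.
move=> fL hL; rewrite /L2_image/= (_ : _ \_ _ = (f \_ Omega) + - (h \_ Omega)).
  have [_ addL] := @Lfun_addr_closed _ _ R mu2 _ (lee1n 2).
  by apply: addL; [exact: fL | rewrite Lfun_oppr_closed].
apply/funext => x; rewrite [in RHS]/GRing.add/= [in RHS]/GRing.opp/= !patchE.
by case: ifP; rewrite ?subr0.
Qed.

Lemma ip_image_sum (I : Type) (r : seq I) f (h : I -> R * R -> R) :
  L2_image f -> (forall i, L2_image (h i)) ->
  ip_image f (fun x => \sum_(i <- r) h i x) = \sum_(i <- r) ip_image f (h i).
Proof.
move=> fL hL; rewrite ip_imageE.
have [H _] := Rintegral_sum r (fun i => integrable_ip fL (hL i)).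
under [RHS]eq_bigr do rewrite ip_imageE.
rewrite -H; apply: eq_Rintegral => x _; rewrite -big_distrr/=; congr (_ * _).
rewrite patchE; case: ifPn => xO; first by apply: eq_bigr => i _; rewrite patchE xO.
by rewrite big1// => i _; rewrite patchE (negbTE xO).
Qed.

Lemma ip_imageB f h1 h2 : L2_image f -> L2_image h1 -> L2_image h2 ->
  ip_image f (h1 \- h2) = ip_image f h1 - ip_image f h2.
Proof.
move=> fL h1L h2L; rewrite !ip_imageE.
rewrite -(RintegralB measurableT (integrable_ip fL h1L) (integrable_ip fL h2L)).
apply: eq_Rintegral => x _; rewrite -mulrBr; congr (_ * _).
by rewrite !patchE; case: ifP; rewrite ?subr0.
Qed.

Lemma norm_image_le h (C : R) :
  (\int[mu2]_x (((h \_ Omega) x) ^+ 2)%:E <= C%:E)%E ->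
  (norm_image h <= (Num.sqrt C)%:E)%E.
Proof.
move=> hC; rewrite /norm_image (Lnorm2E mu2 (h \_ Omega)).
have I0 : (0 <= \int[mu2]_x (((h \_ Omega) x) ^+ 2)%:E)%E.
  by apply: integral_ge0 => x _; rewrite lee_fin sqr_ge0.
rewrite poweR12_sqrt//.
move: hC I0; case: (\int[mu2]_x _)%E => [r| |]//=.
by rewrite !lee_fin => rC r0; exact: ler_wsqrtr.
Qed.

Lemma norm_sino_le (Q : nat) (g : 'I_Q -> R -> R) (C : R) :
  (forall q, \int[mu]_(s in offsets) ((g q s) ^+ 2)%:E <= C%:E)%E ->
  (norm_sino g <= (Num.sqrt (Q%:R * C))%:E)%E.
Proof.
move=> gC; rewrite /norm_sino.
set S := (\sum_q _)%E.
have S0 : (0 <= S)%E.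
  by apply: sume_ge0 => q _; apply: integral_ge0 => s _; rewrite lee_fin sqr_ge0.
have SC : (S <= (Q%:R * C)%:E)%E.
  apply: (@le_trans _ _ (\sum_(q < Q) C%:E)%E).
    apply: lee_sum => q _; apply: le_trans (gC q).
    rewrite le_eqVlt; apply/orP; left; apply/eqP; apply: eq_integral => s _.
    by rewrite real_normK// num_real.
  by rewrite sumEFin sumr_const card_ord mulr_natl.
rewrite poweR12_sqrt//.
move: SC S0; case: S => [r| |]//=.
by rewrite !lee_fin => rC r0; exact: ler_wsqrtr.
Qed.

Definition is_adjoint (Q : nat) (A : (R * R -> R) -> 'I_Q -> R -> R)
    (g : 'I_Q -> R -> R) (h : R * R -> R) : Prop :=
  L2_image h /\ forall f, L2_image f -> ip_sino (A f) g = ip_image f h.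

(** [xget] falls back to the zero function when no representative exists; one explicit
    representative rules this out. *)
Lemma adjointP (Q : nat) (A : (R * R -> R) -> 'I_Q -> R -> R) g h :
  is_adjoint A g h -> is_adjoint A g (adjoint A g).
Proof. by move=> hA; rewrite /adjoint; apply: xgetPex; exists h. Qed.

(* With e the difference of the two adjoints, both of
   <e, adjoint A g - adjoint B g> and <e, h1 - h2> equal <(A - B) e, g>. *)
Lemma adjoint_dist_le (Q : nat) (A B : (R * R -> R) -> 'I_Q -> R -> R) g h1 h2 (C : R) :
  is_adjoint A g h1 -> is_adjoint B g h2 ->
  (\int[mu2]_x ((((h1 \- h2) \_ Omega) x) ^+ 2)%:E <= C%:E)%E ->
  (\int[mu2]_x ((((adjoint A g \- adjoint B g) \_ Omega) x) ^+ 2)%:E <= C%:E)%E.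
Proof.
move=> hA hB hC.
have [aL aP] := adjointP hA; have [bL bP] := adjointP hB.
case: hA hB => [h1L h1P] [h2L h2P].
set e := adjoint A g \- adjoint B g; set d := h1 \- h2.
have eL : L2_image e by exact: L2_imageB.
have dL : L2_image d by exact: L2_imageB.
have ee : ip_image e e = ip_image e d.
  by rewrite [LHS]ip_imageB// [RHS]ip_imageB// -aP// -bP// h1P// h2P.
have /L2_imageP[me e2] := eL; have /L2_imageP[md d2] := dL.
have ed : (ip_image e d)%:E = (\int[mu2]_x ((e \_ Omega) x * (d \_ Omega) x)%:E)%E.
  by rewrite ip_imageE /Rintegral fineK// integrable_fin_num//; exact: integrable_ip.
have eeE : (ip_image e e)%:E = (\int[mu2]_x (((e \_ Omega) x) ^+ 2)%:E)%E.
  rewrite ip_imageE /Rintegral fineK; last first.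
    by rewrite integrable_fin_num//; exact: integrable_ip.
  by apply: eq_integral => x _; rewrite expr2.
rewrite -eeE.
have iS f : L2_image f -> mu2.-integrable setT (fun x => (((f \_ Omega) x) ^+ 2)%:E).
  by move=> fL; under eq_fun do rewrite expr2; exact: integrable_ip.
have dC : ip_image d d <= C.
  rewrite -lee_fin ip_imageE /Rintegral fineK; last first.
    by rewrite integrable_fin_num//; exact: integrable_ip.
  by under eq_integral do rewrite -expr2.
rewrite lee_fin.
(* Together with <e, e> = <e, d> this gives <e, e> <= <d, d>, without comparing representatives
   pointwise. *)
have : 2 * ip_image e d <= ip_image e e + ip_image d d.
  rewrite !ip_imageE -RintegralD//; [|exact: integrable_ip..].
  rewrite -RintegralZl//; last exact: integrable_ip.
  apply: le_Rintegral => //.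
  - have := integrableZl measurableT 2 (integrable_ip eL dL).
    by under eq_fun do rewrite -EFinM.
  - exact: (integrableD measurableT (integrable_ip eL eL) (integrable_ip dL dL)).
  - move=> x _; move: ((e \_ Omega) x) ((d \_ Omega) x) => u v.
    have := sqr_ge0 (u - v); lra.
rewrite -ee; lra.
Qed.

End L2_spaces_facts.

Lemma sqr_sum_le (R : realType) (Q : nat) (x : 'I_Q -> R) :
  (\sum_q x q) ^+ 2 <= Q%:R * \sum_q x q ^+ 2.
Proof.
rewrite expr2 big_distrlr/=.
apply: (@le_trans _ _ (\sum_q \sum_r (x q ^+ 2 / 2 + x r ^+ 2 / 2))).
  apply: ler_sum => q _; apply: ler_sum => r _.
  by have := sqr_ge0 (x q - x r); lra.
rewrite (eq_bigr (fun q => Q%:R * (x q ^+ 2 / 2) + \sum_r x r ^+ 2 / 2)); last first.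
  by move=> q _; rewrite big_split/= sumr_const card_ord mulr_natl.
rewrite big_split/= sumr_const card_ord -mulr_sumr -mulr_suml -mulr_natl; lra.
Qed.

(** * Moduli of continuity of sinograms *)

Section sinograms.
Context {R : realType} (Q : nat).
Local Notation mu := (@lebesgue_measure R).
Variable g : 'I_Q -> R -> R.
Hypothesis gL : L2_sino g.

Let gz q := g q \_ offsets.

Lemma measurable_sino q : measurable_fun setT (g q \_ offsets).
Proof. by have /Lfun2P[] := gL q. Qed.

Lemma sino_L2 q : (\int[mu]_s (((g q \_ offsets) s) ^+ 2)%:E < +oo)%E.
Proof. by have /Lfun2P[] := gL q. Qed.

Lemma sino_eq0 q s : ~ offsets s -> (g q \_ offsets) s = 0.
Proof. by move=> so; rewrite patchE memNset. Qed.

Let modulus q h := (\int[mu]_s ((gz q (s + h) - gz q s) ^+ 2)%:E)%E.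

Lemma sino_translation_cvg (e : R) : 0 < e ->
  \forall h \near (0 : R), forall q, (modulus q h <= e%:E)%E.
Proof.
move=> e0.
suff H q : \forall h \near (0 : R), (modulus q h <= e%:E)%E.
  exact: (@filter_forall _ _ (fun q h => (modulus q h <= e%:E)%E) _ _ H).
have g0 s : 1 <= `|s| -> gz q s = 0.
  move=> s1; apply: sino_eq0; rewrite /offsets/= in_itv/= -ltr_norml.
  by apply/negP; rewrite -leNgt.
exact: (translation_cvg_L2 (measurable_sino q) (sino_L2 q) g0 e0).
Qed.

(** [omega] is built from real-valued integrals, and [fine] sends an infinite one to 0. Finiteness
    is what lets [omega] bound the extended modulus. *)
Lemma modulus_lty q h : (modulus q h < +oo)%E.
Proof.
have mg := measurable_sino q.
have mgh : measurable_fun setT (fun s : R => gz q (s + h)).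
  by apply: measurableT_comp mg _; exact: measurable_funD.
have mg2 : measurable_fun setT (fun s => ((gz q s) ^+ 2)%:E).
  by apply/measurable_EFinP; exact: measurable_funX.
have mgh2 : measurable_fun setT (fun s : R => ((gz q (s + h)) ^+ 2)%:E).
  by apply/measurable_EFinP; exact: measurable_funX.
apply: (@le_lt_trans _ _
    (\int[mu]_s (2%:E * ((gz q (s + h)) ^+ 2)%:E + 2%:E * ((gz q s) ^+ 2)%:E))%E).
  apply: ge0_le_integral => //.
  - by move=> s _; rewrite lee_fin sqr_ge0.
  - apply/measurable_EFinP; apply: measurable_funX; exact: measurable_funB.
  - by apply: emeasurable_funD; exact: measurable_funeM.
  move=> s _; rewrite -!EFinM -EFinD lee_fin.
  by have := sqr_ge0 (gz q (s + h) + gz q s); lra.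
have s0 (s : R) : (0 <= ((gz q s) ^+ 2)%:E)%E by rewrite lee_fin sqr_ge0.
have n2 : (0 <= 2%:E :> \bar R)%E by rewrite lee_fin.
rewrite ge0_integralD//; first last.
- exact: measurable_funeM.
- by move=> s _; rewrite mule_ge0.
- exact: measurable_funeM.
- by move=> s _; rewrite mule_ge0.
rewrite !ge0_integralZl//.
rewrite (ge0_integralD_shift h (f := fun s => ((gz q s) ^+ 2)%:E))//.
by rewrite lte_add_pinfty// lte_mul_pinfty//; exact: sino_L2.
Qed.

Lemma modulus_le_omega q h : (modulus q h <= (omega g h ^+ 2)%:E)%E.
Proof.
have m0 q' : 0 <= \int[mu]_s (`|gz q' (s + h) - gz q' s| ^+ 2).
  by apply: Rintegral_ge0 => s _; rewrite sqr_ge0.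
rewrite /omega sqr_sqrtr; last by apply: sumr_ge0 => q' _; exact: m0.
rewrite (bigD1 q)//= EFinD.
have <- : modulus q h = (\int[mu]_s (`|gz q (s + h) - gz q s| ^+ 2))%:E.
  rewrite /Rintegral fineK.
    by apply: eq_integral => s _; rewrite real_normK// num_real.
  rewrite ge0_fin_numE; last by apply: integral_ge0 => s _; rewrite lee_fin sqr_ge0.
  apply: le_lt_trans (modulus_lty q h); rewrite le_eqVlt; apply/orP; left; apply/eqP.
  by apply: eq_integral => s _; rewrite real_normK// num_real.
rewrite leeDl// lee_fin; apply: sumr_ge0 => q' _; exact: m0.
Qed.

Lemma modulus0 q : (modulus q 0 = 0)%E.
Proof.
rewrite /modulus; under eq_integral do rewrite addr0 subrr expr0n.
by rewrite integral0.
Qed.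

(** The asymptotic hypothesis concerns the punctured filter [0^']. At h = 0 the modulus vanishes, so
    the bound holds on a full neighbourhood, as windows around 0 require. *)
Lemma sino_modulus_bigO (eps : R) : 
  omega g =O_ (0^') (fun h : R => `|h| `^ eps) ->
  exists2 c, 0 < c & \forall h \near (0 : R), forall q,
    (modulus q h <= ((c * `|h| `^ eps) ^+ 2)%:E)%E.
Proof.
move=> /eqO_exP[c c0 H]; exists c => //.
have {}H : \forall h \near (0 : R), h != 0 ->
  `|omega g h| <= c * `| `|h| `^ eps| := H.
apply: filterS H => h H q; have [->|h0] := eqVneq h 0.
  by rewrite modulus0 lee_fin sqr_ge0.
apply: le_trans (modulus_le_omega q h) _; rewrite lee_fin.
have := H h0; rewrite (ger0_norm (powR_ge0 _ _)) => {}H.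
rewrite -(real_normK (num_real (omega g h))) ler_sqr ?nnegrE//.
by rewrite mulr_ge0 ?powR_ge0// ltW.
Qed.

End sinograms.

(** * Error bounds for one discretization *)

Section error_bounds.
Context {R : realType} (Q : nat) (phi : 'I_Q -> R).
Local Notation mu := (@lebesgue_measure R).
Local Notation RR := (measurableTypeR R * measurableTypeR R)%type.
Local Notation mu2 := (mu \x mu)%E.

Lemma radonE f q : radon phi f q = xray (phi q) (f \_ Omega).
Proof. by []. Qed.

(** Lines with |s| >= 1 miss [Omega], so extension by zero is harmless. *)
Lemma radon_patch f q : L2_image f -> radon phi f q \_ offsets = radon phi f q.
Proof.
move=> /L2_imageP[mf f2]; apply/funext => s; rewrite patchE; case: ifPn => // so.
rewrite radonE (xray_eq0 _ (@patch_Omega_eq0 _ f))// leNgt ltr_norml.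
by apply: contra so => s1; apply: mem_set; rewrite /offsets/= in_itv.
Qed.

Lemma radon_L2 f : L2_image f -> L2_sino (radon phi f).
Proof.
move=> fL q; have /L2_imageP[mf f2] := fL; rewrite radon_patch//; apply/Lfun2P.
have f0 := @patch_Omega_eq0 _ f.
rewrite radonE; split; first exact: measurable_xray.
apply: le_lt_trans (integral_xray_sqr_le (phi q) mf f2 f0) _.
by rewrite lte_mul_pinfty ?lee_fin.
Qed.

Lemma ip_sinoE (u g : 'I_Q -> R -> R) :
  ip_sino u g = \sum_q \int[mu]_s (u q s * (g q \_ offsets) s).
Proof.
apply: eq_bigr => q _; rewrite Rintegral_mkcond; apply: eq_Rintegral => s _.
by rewrite !patchE; case: ifP => _; rewrite ?mulr0.
Qed.

Variable g : 'I_Q -> R -> R.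
Hypothesis gL : L2_sino g.

Let mg := measurable_sino gL.
Let g2 := sino_L2 gL.
Let g0 q := @sino_eq0 R Q g q.

Lemma L2_backprojection q : L2_image (backprojection (phi q) (g q \_ offsets)).
Proof.
apply/L2_imageP; split; last exact: backprojection_L2.
apply: (measurable_restrictT _ measurable_Omega).1.
by apply: measurable_funTS; exact: measurable_backprojection.
Qed.

Lemma radon_is_adjoint : is_adjoint (radon phi) g
  (fun x => \sum_q backprojection (phi q) (g q \_ offsets) x).
Proof.
split; first by apply: L2_image_sum => q; exact: L2_backprojection.
move=> f fL; rewrite ip_image_sum//; last exact: L2_backprojection.
have /L2_imageP[mf f2] := fL; have f0 := @patch_Omega_eq0 _ f.
rewrite ip_sinoE; apply: eq_bigr => q _.
rewrite ip_imageE /Rintegral (radon_duality (phi q) (mg q) (g2 q) mf f2 f0).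
by congr fine; apply: eq_integral => x _; rewrite (patch_Omega_mul f0).
Qed.

Variable D : @discretization R.
Local Notation ds := (delta_s D).
Local Notation dx := (delta_x D).

Lemma L2_discrete_backprojection q :
  L2_image (discrete_backprojection (phi q) (g q \_ offsets) D).
Proof.
apply/L2_imageP; split; first exact: (measurable_discrete_backprojection _ (mg q) (g2 q) (@g0 q)).
exact: (discrete_backprojection_L2 _ (mg q) (g2 q) (@g0 q)).
Qed.

Lemma discrete_radonE f q s : L2_image f -> offsets s ->
  discrete_radon phi D f q s = (ds ^+ 2)^-1 *
    \int[mu2]_x (discrete_kernel D (phi q) x s * (f \_ Omega) x).
Proof.
move=> /L2_imageP[mf f2] so; have f0 := @patch_Omega_eq0 _ f.
exact: (discrete_radon_kernel D (phi q) mf f2 f0 so).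
Qed.

Lemma discrete_radon_is_adjoint : is_adjoint (discrete_radon phi D) g
  (fun x => \sum_q discrete_backprojection (phi q) (g q \_ offsets) D x).
Proof.
split; first by apply: L2_image_sum => q; exact: L2_discrete_backprojection.
move=> f fL; rewrite ip_image_sum//; last exact: L2_discrete_backprojection.
have /L2_imageP[mf f2] := fL; have f0 := @patch_Omega_eq0 _ f.
rewrite ip_sinoE; apply: eq_bigr => q _.
rewrite ip_imageE /Rintegral.
transitivity (fine (\int[mu2]_x ((f \_ Omega) x *
    discrete_backprojection (phi q) (g q \_ offsets) D x)%:E)%E); last first.
  by congr fine; apply: eq_integral => x _; rewrite (patch_Omega_mul f0).
rewrite -(discrete_radon_duality (phi q) (mg q) (g2 q) (@g0 q) D mf f2 f0).
congr fine; apply: eq_integral => s _.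
(* The kernel form is known on ]-1, 1[ only; elsewhere the zero extension of [g] annihilates both
   sides. *)
have [so|so] := pselect (offsets s); first by rewrite discrete_radonE.
by rewrite g0// !mulr0.
Qed.

Lemma measurable_discrete_radon f q : measurable_fun setT (discrete_radon phi D f q).
Proof.
apply: measurable_funM => //; apply: measurable_sum => p.
by apply: measurable_funM => //; apply: measurable_indic; exact: measurable_itv.
Qed.

Hypothesis dxs : dx <= ds.

Lemma norm_sino_error_le f (M N : R) : L2_image f ->
  (forall h, `|h| <= 3 * ds -> forall q,
    (\int[mu]_s (((radon phi f q \_ offsets) (s + h) - (radon phi f q \_ offsets) s) ^+ 2)%:E
     <= M%:E)%E) ->
  (\int[mu2]_x (((f \_ Omega) x) ^+ 2)%:E <= N%:E)%E ->
  (norm_sino (radon phi f \- discrete_radon phi D f)%R <=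
     (Num.sqrt (Q%:R * (72 * M + 144 * (dx / ds) ^+ 2 * N)))%:E)%E.
Proof.
move=> fL fM fN; have /L2_imageP[mf f2] := fL; have f0 := @patch_Omega_eq0 _ f.
apply: norm_sino_le => q.
apply: (integral_forward_error_le dxs mf f2 f0) => //.
- exact: measurable_discrete_radon.
- by move=> s so; exact: discrete_radonE.
- by move=> h hs; have := fM h hs q; rewrite radon_patch.
Qed.

(** The backprojections of different angles overlap in [Omega]: one factor Q comes from
    [sqr_sum_le], the other from adding Q bounds 72 M. In the sinogram norm the angles are separate,
    and a single Q appears. *)
Lemma norm_image_error_le (M : R) :
  (forall h, `|h| <= 3 * ds -> forall q,
    (\int[mu]_s (((g q \_ offsets) (s + h) - (g q \_ offsets) s) ^+ 2)%:E <= M%:E)%E) ->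
  (norm_image (adjoint (radon phi) g \- adjoint (discrete_radon phi D) g)%R <=
     (Num.sqrt (72 * Q%:R ^+ 2 * M))%:E)%E.
Proof.
move=> gM; apply: norm_image_le.
apply: adjoint_dist_le radon_is_adjoint discrete_radon_is_adjoint _.
pose b q := backprojection (phi q) (g q \_ offsets).
pose c q := discrete_backprojection (phi q) (g q \_ offsets) D.
pose e q x := (b q \_ Omega) x - (c q \_ Omega) x.
have me q : measurable_fun setT (e q : RR -> R).
  apply: measurable_funB; last first.
    exact: (measurable_discrete_backprojection _ (mg q) (g2 q) (@g0 q)).
  by have /L2_imageP[] := L2_backprojection q.
have me2 q : measurable_fun setT (fun x : RR => (e q x ^+ 2)%:E).
  by apply/measurable_EFinP; exact: measurable_funX.
have e20 q x : (0 <= (e q x ^+ 2)%:E)%E by rewrite lee_fin sqr_ge0.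
have L := L2_imageB (L2_image_sum (index_enum 'I_Q) L2_backprojection)
  (L2_image_sum (index_enum 'I_Q) L2_discrete_backprojection).
have /L2_imageP[mL _] := L.
apply: (@le_trans _ _ (\int[mu2]_x (Q%:R%:E * \sum_q (e q x ^+ 2)%:E))%E).
  apply: ge0_le_integral => //.
  - by move=> x _; rewrite lee_fin sqr_ge0.
  - by apply/measurable_EFinP; exact: measurable_funX.
  - by apply: measurable_funeM; apply: emeasurable_sum.
  move=> x _; rewrite sumEFin -EFinM lee_fin.
  apply: le_trans (sqr_sum_le _); rewrite le_eqVlt; apply/orP; left; apply/eqP.
  congr (_ ^+ 2); rewrite patchE /e; case: ifPn => xO.
    by rewrite /= -sumrB; apply: eq_bigr => q _; rewrite !patchE xO.
  by rewrite big1// => q _; rewrite !patchE (negbTE xO) subr0.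
rewrite ge0_integralZl//; last 2 first.
- by apply: emeasurable_sum.
- by move=> x _; apply: sume_ge0.
rewrite ge0_integral_sum//.
apply: (@le_trans _ _ (Q%:R%:E * \sum_(q < Q) (72 * M)%:E)%E).
  apply: lee_wpmul2l; first by rewrite lee_fin.
  apply: lee_sum => q _.
  apply: (integral_backprojection_error_le (phi q) (mg q) (g2 q) (@g0 q)) => //.
  by move=> h hs; exact: gM.
rewrite sumEFin sumr_const card_ord -EFinM lee_fin -mulr_natl le_eqVlt.
by apply/orP; left; apply/eqP; ring.
Qed.

End error_bounds.

(** * Convergence *)

Lemma cvge0_le (R : realType) (I : Type) (F : set_system I) {FF : Filter F}
    (u : I -> \bar R) : (forall i, 0 <= u i)%E ->
  (forall e : R, 0 < e -> \forall i \near F, (u i <= e%:E)%E) ->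
  u i @[i --> F] --> 0%E.
Proof.
move=> u0 ue; apply/fine_cvgP; split.
  by apply: filterS (ue 1 ltr01) => i ui; rewrite ge0_fin_numE// (le_lt_trans ui)// ltry.
apply/cvgr0Pnorm_le => e e0; apply: filterS (ue e e0) => i /=.
by move: (u0 i); case: (u i) => [r| |]//=; rewrite !lee_fin => r0; rewrite ger0_norm.
Qed.

Lemma near_window (R : realType) (I : Type) (F : set_system I) {FF : Filter F}
    (d : I -> R) (P : R -> Prop) : d i @[i --> F] --> 0 ->
  (\forall h \near (0 : R), P h) ->
  \forall i \near F, forall h, `|h| <= 3 * d i -> P h.
Proof.
move=> /cvgr0Pnorm_le d0 /nbhs_norm0P[r /= r0 rP].
(* Chosen so that 3 (r / 4) < r. *)
have r4 : 0 < r / 4 by rewrite divr_gt0.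
apply: filterS (d0 _ r4) => i di h hd; apply: rP => /=.
have := ler_norm (d i); lra.
Qed.

Lemma norm_sino_ge0 (R : realType) (Q : nat) (g : 'I_Q -> R -> R) : (0 <= norm_sino g)%E.
Proof. exact: poweR_ge0. Qed.

Lemma norm_image_ge0 (R : realType) (f : R * R -> R) : (0 <= norm_image f)%E.
Proof. exact: Lnorm_ge0. Qed.

Lemma fine_le_sqrt (R : realType) (u : \bar R) (K t : R) : 0 <= K -> 0 <= t ->
  (0 <= u)%E -> (u <= (Num.sqrt (K * t ^+ 2))%:E)%E ->
  `|fine u| <= Num.sqrt K * t.
Proof.
move=> K0 t0; case: u => [r| |]//= r0; rewrite !lee_fin => H.
rewrite ger0_norm// (le_trans H)// sqrtrM// sqrtr_sqr ger0_norm//.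
Qed.

Theorem theorem2p16 (R : realType) (Q : nat) (phi : 'I_Q -> R)
    (phi_range : forall q, - pi <= phi q < pi)
    (phi_incr : forall q r : 'I_Q, (q < r)%N -> phi q < phi r)
    (I : Type) (F : filter_on I)
    (D : I -> @discretization R)
    (ds_cvg0 : delta_s (D i) @[i --> F] --> 0)
    (dx_ds_cvg0 : delta_x (D i) / delta_s (D i) @[i --> F] --> 0) :
  (forall (f : R * R -> R) (g : 'I_Q -> R -> R),
      L2_image f -> L2_sino g ->
      norm_sino (radon phi f \- discrete_radon phi (D i) f) @[i --> F] --> 0%E
      /\
      norm_image (adjoint (radon phi) g
                  \- adjoint (discrete_radon phi (D i)) g) @[i --> F] --> 0%E)
  /\
  (forall eps : R, 0 < eps ->
    (fun i => delta_x (D i)) =O_F (fun i => delta_s (D i) `^ (1 + eps)) ->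
    forall (f : R * R -> R) (g : 'I_Q -> R -> R),
      L2_image f ->
      omega (radon phi f) =O_ (0^') (fun h : R => `|h| `^ eps) ->
      L2_sino g ->
      omega g =O_ (0^') (fun h : R => `|h| `^ eps) ->
      (fun i => fine (norm_sino (radon phi f \- discrete_radon phi (D i) f)))
        =O_F (fun i => delta_s (D i) `^ eps)
      /\
      (fun i => fine (norm_image (adjoint (radon phi) g
                                  \- adjoint (discrete_radon phi (D i)) g)))
        =O_F (fun i => delta_s (D i) `^ eps)).
Proof.
(* The error bounds assume dx <= ds, which the vanishing ratio gives eventually. *)
have dxs : \forall i \near F, delta_x (D i) <= delta_s (D i).
  move/cvgr0Pnorm_le: dx_ds_cvg0 => /(_ 1 ltr01); apply: filterS => i.
  by move=> /(le_trans (ler_norm _)); rewrite ler_pdivrMr ?delta_s_gt0// mul1r.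
have norm2 f : L2_image f -> exists2 N : R, 0 <= N &
    (\int[leb2]_x (((f \_ Omega) x) ^+ 2)%:E <= N%:E)%E.
  move=> /L2_imageP[_].
  have : (0 <= \int[leb2]_x (((f \_ Omega) x) ^+ 2)%:E)%E.
    by apply: integral_ge0 => x _; rewrite lee_fin sqr_ge0.
  by case: (\int[leb2]_x _)%E => [N| |]//= N0 _; exists N.
split=> [f g fL gL | eps eps0 dxO f g fL fO gL gO].
  have [N N0 fN] := norm2 f fL.
  split; apply: cvge0_le => [i | e e0].
  - exact: norm_sino_ge0.
  (* Once the modulus and (dx / ds)^2 are at most [m], the squared error is at most (K - 1) m <=
     e^2. The summand 1 keeps [K] positive when Q = 0. *)
  - pose K := Q%:R * (72 + 144 * N) + 1.
    have K0 : 0 < K.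
      by apply: ltr_pwDr; [exact: ltr01 | rewrite mulr_ge0 ?addr_ge0 ?mulr_ge0].
    pose m := e ^+ 2 / K.
    have m0 : 0 < m by rewrite divr_gt0// exprn_gt0.
    have W := near_window ds_cvg0 (sino_translation_cvg (radon_L2 phi fL) m0).
    (* A ratio at most 1 and at most [m] has its square at most [m]. *)
    have rho1 := (cvgr0Pnorm_le _).1 dx_ds_cvg0 _ (ltr01 : 0 < 1 :> R).
    have rhom := (cvgr0Pnorm_le _).1 dx_ds_cvg0 _ m0.
    near=> i.
    have di : delta_x (D i) <= delta_s (D i) by near: i; exact: dxs.
    have Wi : forall h, `|h| <= 3 * delta_s (D i) -> forall q,
      (\int[leb]_s (((radon phi f q \_ offsets) (s + h)
          - (radon phi f q \_ offsets) s) ^+ 2)%:E <= m%:E)%E by near: i; exact: W.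
    have r1 : `|delta_x (D i) / delta_s (D i)| <= 1 by near: i; exact: rho1.
    have rm : `|delta_x (D i) / delta_s (D i)| <= m by near: i; exact: rhom.
    have H := norm_sino_error_le di fL Wi fN.
    apply: (le_trans H).
    rewrite lee_fin -[leRHS](ger0_norm (ltW e0)) -sqrtr_sqr ler_wsqrtr//.
    set rho := _ / _ in r1 rm *.
    have rho2 : rho ^+ 2 <= m.
      rewrite -(real_normK (num_real rho)) expr2.
      by apply: le_trans rm; rewrite ler_piMl.
    apply: (@le_trans _ _ (Q%:R * (72 * m + 144 * m * N))).
      by apply: ler_wpM2l => //; rewrite lerD2l; apply: ler_wpM2r => //; apply: ler_wpM2l.
    have -> : e ^+ 2 = K * m by rewrite mulrC divfK// gt_eqF.
    rewrite /K mulrDl mul1r; lra.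
  - exact: norm_image_ge0.
  - pose m := e ^+ 2 / (72 * Q%:R ^+ 2 + 1).
    have K0 : 0 < 72 * Q%:R ^+ 2 + 1 :> R by rewrite ltr_pwDr// mulr_ge0// sqr_ge0.
    have m0 : 0 < m by rewrite divr_gt0// exprn_gt0.
    have W := near_window ds_cvg0 (sino_translation_cvg gL m0).
    near=> i.
    have di : delta_x (D i) <= delta_s (D i) by near: i; exact: dxs.
    have Wi : forall h, `|h| <= 3 * delta_s (D i) -> forall q,
      (\int[leb]_s (((g q \_ offsets) (s + h)
          - (g q \_ offsets) s) ^+ 2)%:E <= m%:E)%E by near: i; exact: W.
    have H := norm_image_error_le phi gL di Wi.
    apply: (le_trans H).
    rewrite lee_fin -[leRHS](ger0_norm (ltW e0)) -sqrtr_sqr ler_wsqrtr//.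
    have -> : e ^+ 2 = (72 * Q%:R ^+ 2 + 1) * m by rewrite mulrC divfK// gt_eqF.
    by rewrite mulrDl mul1r; lra.
have [N N0 fN] := norm2 f fL.
have [c1 c10 W1] := sino_modulus_bigO (radon_L2 phi fL) fO.
have [c2 c20 W2] := sino_modulus_bigO gL gO.
have {}W1 := near_window ds_cvg0 W1; have {}W2 := near_window ds_cvg0 W2.
have /eqO_exP[k k0 dxk] := dxO.
(* Shifts go up to 3 ds, which is the origin of the factor 3^eps in the constants below. *)
have powle c (d h : R) : 0 < c -> 0 < d -> `|h| <= 3 * d ->
    (c * `|h| `^ eps) ^+ 2 <= (c * 3 `^ eps) ^+ 2 * (d `^ eps) ^+ 2.
  move=> c0 d0 hd; rewrite -exprMn -mulrA -powRM ?(ltW d0)//.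
  rewrite ler_sqr ?nnegrE ?mulr_ge0 ?powR_ge0 ?(ltW c0)// ler_pM2l//.
  apply: ge0_ler_powR => //; rewrite ?nnegrE ?(ltW eps0)//.
  by rewrite mulr_ge0// ltW.
split; apply/eqO_exP.
- pose K := Q%:R * (72 * (c1 * 3 `^ eps) ^+ 2 + 144 * k ^+ 2 * N).
  have K0 : 0 <= K.
    apply: mulr_ge0; [exact: ler0n | apply: addr_ge0; apply: mulr_ge0 => //].
      exact: sqr_ge0.
    by apply: mulr_ge0; [exact: ler0n | exact: sqr_ge0].
  (* The summand 1 provides a positive constant even if [K] is 0. *)
  exists (Num.sqrt K + 1); first by rewrite ltr_wpDl// sqrtr_ge0.
  near=> i.
  have di : delta_x (D i) <= delta_s (D i) by near: i; exact: dxs.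
  have d0 := delta_s_gt0 (D i).
  have Wi : forall h, `|h| <= 3 * delta_s (D i) -> forall q,
    (\int[leb]_s (((radon phi f q \_ offsets) (s + h)
        - (radon phi f q \_ offsets) s) ^+ 2)%:E <=
     ((c1 * `|h| `^ eps) ^+ 2)%:E)%E by near: i; exact: W1.
  have dxi : `|delta_x (D i)| <= k * `|delta_s (D i) `^ (1 + eps)| by near: i; exact: dxk.
  set t := delta_s (D i) `^ eps.
  have t0 : 0 <= t by exact: powR_ge0.
  rewrite (ger0_norm t0); apply: (@le_trans _ _ (Num.sqrt K * t)); last first.
    by rewrite ler_wpM2r// lerDl.
  apply: fine_le_sqrt => //; first exact: norm_sino_ge0.
  have Wi' : forall h, `|h| <= 3 * delta_s (D i) -> forall q,
    (\int[leb]_s (((radon phi f q \_ offsets) (s + h)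
        - (radon phi f q \_ offsets) s) ^+ 2)%:E <=
     ((c1 * 3 `^ eps) ^+ 2 * t ^+ 2)%:E)%E.
    by move=> h hd q; apply: le_trans (Wi h hd q) _; rewrite lee_fin powle.
  apply: le_trans (norm_sino_error_le di fL Wi' fN) _.
  rewrite lee_fin; apply: ler_wsqrtr; rewrite /K -[leRHS]mulrA.
  apply: ler_wpM2l; first exact: ler0n.
  (* Dividing dx <= k ds^(1+eps) by ds leaves k ds^eps, which is k t. *)
  have rho : (delta_x (D i) / delta_s (D i)) ^+ 2 <= k ^+ 2 * t ^+ 2.
    rewrite -exprMn ler_sqr ?nnegrE ?divr_ge0 ?mulr_ge0 ?(ltW k0)
       ?(ltW d0) ?(ltW (delta_x_gt0 _))//.
    rewrite ler_pdivrMr//; apply: le_trans (ler_norm _) _; apply: le_trans dxi _.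
    have -> : delta_s (D i) `^ (1 + eps) = t * delta_s (D i).
      rewrite powRD; first by rewrite powRr1 ?(ltW d0)// mulrC.
      by rewrite (gt_eqF d0) implybT.
    by rewrite ger0_norm ?mulr_ge0 ?(ltW d0)// mulrA.
  rewrite [leRHS](_ : _ = 72 * ((c1 * 3 `^ eps) ^+ 2 * t ^+ 2) +
    144 * (k ^+ 2 * t ^+ 2) * N); last by ring.
  rewrite lerD2l.
  by apply: ler_wpM2r => //; apply: ler_wpM2l => //; exact: ler0n.
- pose K := 72 * Q%:R ^+ 2 * (c2 * 3 `^ eps) ^+ 2.
  have K0 : 0 <= K.
    by apply: mulr_ge0; [apply: mulr_ge0; [exact: ler0n |] |]; exact: sqr_ge0.
  exists (Num.sqrt K + 1); first by rewrite ltr_wpDl// sqrtr_ge0.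
  near=> i.
  have di : delta_x (D i) <= delta_s (D i) by near: i; exact: dxs.
  have d0 := delta_s_gt0 (D i).
  have Wi : forall h, `|h| <= 3 * delta_s (D i) -> forall q,
    (\int[leb]_s (((g q \_ offsets) (s + h) - (g q \_ offsets) s) ^+ 2)%:E <=
     ((c2 * `|h| `^ eps) ^+ 2)%:E)%E by near: i; exact: W2.
  set t := delta_s (D i) `^ eps.
  have t0 : 0 <= t by exact: powR_ge0.
  rewrite (ger0_norm t0); apply: (@le_trans _ _ (Num.sqrt K * t)); last first.
    by rewrite ler_wpM2r// lerDl.
  apply: fine_le_sqrt => //; first exact: norm_image_ge0.
  have Wi' : forall h, `|h| <= 3 * delta_s (D i) -> forall q,
    (\int[leb]_s (((g q \_ offsets) (s + h) - (g q \_ offsets) s) ^+ 2)%:E <=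
     ((c2 * 3 `^ eps) ^+ 2 * t ^+ 2)%:E)%E.
    by move=> h hd q; apply: le_trans (Wi h hd q) _; rewrite lee_fin powle.
  apply: le_trans (norm_image_error_le phi gL di Wi') _.
  by rewrite lee_fin /K -!mulrA.
Unshelve. all: by end_near. Qed.
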